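(* Let $n\ge 2$, let $K$ be a field, and let $A$ be a total associative $n$-algebra over $K$. Then the Lie $n$-commutator algebra $[A]$ satisfies the identity $f^{[2]}_{-1}=0$; that is, $F^{[2]}_1(a_1,\ldots,a_{3n-2})-F^{[2]}_2(a_1,\ldots,a_{3n-2})=0$ for all $a_1,\ldots,a_{3n-2}\in A$, where $F^{[2]}_1,F^{[2]}_2$ are evaluated with $\omega$ equal to the Lie $n$-commutator of $A$.
   Context: An $n$-algebra over $K$ is a $K$-vector space $A$ with a multilinear map $A\times\cdots\times A\to A$ of $n$ arguments, $(a_1,\ldots,a_n)\mapsto(a_1,\ldots,a_n)$. It is total associative if $$(a_1,\ldots,a_i,(a_{i+1},\ldots,a_{i+n}),a_{i+n+1},\ldots,a_{2n-1})=(a_1,\ldots,a_{i+1},(a_{i+2},\ldots,a_{i+n+1}),a_{i+n+2},\ldots,a_{2n-1})$$ for all $0\le i\le n-2$ and all $a_1,\ldots,a_{2n-1}\in A$. $Sym_m$ is the group of permutations of $\{1,\ldots,m\}$. The algebra $[A]$ is the vector space $A$ with the $n$-multiplication (Lie $n$-commutator) $$[a_1,\ldots,a_n]=\sum_{\sigma\in Sym_n}\operatorname{sign}(\sigma)\,(a_{\sigma(1)},\ldots,a_{\sigma(n)}).$$ Sets of shuffle permutations: $$S_{n-1,n-1,n}=\{\sigma\in Sym_{3n-2}: \sigma(1)<\cdots<\sigma(n-1),\ \sigma(n)<\cdots<\sigma(2n-2),\ \sigma(2n-1)<\cdots<\sigma(3n-2)\},$$ $$S_{n-2,n,n}=\{\sigma\in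 Sym_{3n-2}: \sigma(1)<\cdots<\sigma(n-2),\ \sigma(n-1)<\cdots<\sigma(2n-2),\ \sigma(2n-1)<\cdots<\sigma(3n-2),\ \sigma(n-1)<\sigma(2n-1)\}.$$ For an $n$-ary operation $\omega$, $$F^{[2]}_1(t_1,\ldots,t_{3n-2})=\sum_{\substack{\sigma\in S_{n-1,n-1,n}\\ \sigma(n)=1}}\operatorname{sign}(\sigma)\,\omega\bigl(t_{\sigma(1)},\ldots,t_{\sigma(n-1)},\omega(t_1,t_{\sigma(n+1)},\ldots,t_{\sigma(2n-2)},\omega(t_{\sigma(2n-1)},\ldots,t_{\sigma(3n-2)}))\bigr),$$ $$F^{[2]}_2(t_1,\ldots,t_{3n-2})=\sum_{\substack{\sigma\in S_{n-2,n,n}\\ \sigma(n-1)=1}}\operatorname{sign}(\sigma)\,\omega\bigl(t_{\sigma(1)},\ldots,t_{\sigma(n-2)},\omega(t_1,t_{\sigma(n)},\ldots,t_{\sigma(2n-2)}),\omega(t_{\sigma(2n-1)},\ldots,t_{\sigma(3n-2)})\bigr),$$ and $f^{[2]}_\lambda=F^{[2]}_1+\lambda F^{[2]}_2$. Here $\operatorname{sign}(\sigma)$ is the sign of $\sigma$ as an element of $Sym_{3n-2}$. *)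

(* Defs.v *)
From mathcomp Require Import all_boot all_algebra all_fingroup.

Set Implicit Arguments.
Unset Strict Implicit.
Unset Printing Implicit Defensive.

Import GRing.Theory.
Local Open Scope ring_scope.

(* [seg i j s] is s_i, ..., s_j with entries numbered from 1; it is empty when
   j = i - 1. *)
Definition seg (T : Type) (i j : nat) (s : seq T) : seq T :=
  drop i.-1 (take j s).

Definition is_multilinear (K : fieldType) (A : lmodType K) (n : nat)
    (mu : n.-tuple A -> A) : Prop :=
  forall (i : 'I_n) (a : n.-tuple A) (c : K) (x y : A),
    let mu_i z := mu [tuple if j == i then z else tnth a j | j < n] in
    mu_i (c *: x + y) = c *: mu_i x + mu_i y.

(* An n-ary operation applied to a list of arguments. It is only used on lists
   of length n, so the default entry 0 of s`_j is never reached. *)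
Definition apply_op (V : nmodType) (n : nat) (mu : n.-tuple V -> V)
    (s : seq V) : V :=
  mu [tuple s`_j | j < n].

Lemma apply_op_tuple (V : nmodType) (n : nat) (mu : n.-tuple V -> V)
  (t : n.-tuple V) : apply_op mu t = mu t.
Proof.
by congr mu; apply: eq_from_tnth => j; rewrite tnth_mktuple (tnth_nth 0).
Qed.

Definition total_associative (V : nmodType) (n : nat)
    (mu : n.-tuple V -> V) : Prop :=
  forall (i : nat) (a : (2 * n - 1).-tuple V), (i <= n - 2)%N ->
    apply_op mu
      (seg 1 i a ++
       apply_op mu (seg i.+1 (i + n) a) :: seg (i + n + 1) (2 * n - 1) a) =
    apply_op mu
      (seg 1 i.+1 a ++
       apply_op mu (seg (i + 2) (i + n + 1) a) ::
       seg (i + n + 2) (2 * n - 1) a).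

(* (t_{s(1)}, ..., t_{s(m)}) *)
Definition permute (T : Type) (m : nat) (s : 'S_m) (t : m.-tuple T) :
  m.-tuple T := [tuple tnth t (s i) | i < m].

Definition lie_commutator (K : fieldType) (A : lmodType K) (n : nat)
    (mu : n.-tuple A -> A) (a : n.-tuple A) : A :=
  \sum_(s : 'S_n) (-1 : K) ^+ s *: mu (permute s a).

(* The one-line notation s(1), ..., s(m) with values in {1, ..., m}: elements
   of 'I_m are shifted by one. *)
Definition oneline (m : nat) (s : 'S_m) : seq nat :=
  [seq (val (s i)).+1 | i <- enum 'I_m].

(* s(i), for 1 <= i <= m *)
Definition perm_at (m : nat) (s : 'S_m) (i : nat) : nat :=
  nth 0%N (oneline s) i.-1.

Definition increasing_on (m : nat) (s : 'S_m) (i j : nat) : bool :=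
  sorted ltn (seg i j (oneline s)).

(* S_{n-1,n-1,n} *)
Definition shuffle1 (n : nat) : {set 'S_(3 * n - 2)} :=
  [set s | [&& increasing_on s 1 (n - 1),
               increasing_on s n (2 * n - 2)
             & increasing_on s (2 * n - 1) (3 * n - 2)]].

(* S_{n-2,n,n} *)
Definition shuffle2 (n : nat) : {set 'S_(3 * n - 2)} :=
  [set s | [&& increasing_on s 1 (n - 2),
               increasing_on s (n - 1) (2 * n - 2),
               increasing_on s (2 * n - 1) (3 * n - 2)
             & (perm_at s (n - 1) < perm_at s (2 * n - 1))%N]].

(* t`_0 is t_1 *)
Definition F1 (K : fieldType) (A : lmodType K) (n : nat)
    (w : n.-tuple A -> A) (t : (3 * n - 2).-tuple A) : A :=
  \sum_(s in shuffle1 n | perm_at s n == 1%N)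
    let u := permute s t in
    (-1 : K) ^+ s *:
      apply_op w (seg 1 (n - 1) u ++
        [:: apply_op w (t`_0 :: seg (n + 1) (2 * n - 2) u ++
              [:: apply_op w (seg (2 * n - 1) (3 * n - 2) u)])]).

Definition F2 (K : fieldType) (A : lmodType K) (n : nat)
    (w : n.-tuple A -> A) (t : (3 * n - 2).-tuple A) : A :=
  \sum_(s in shuffle2 n | perm_at s (n - 1) == 1%N)
    let u := permute s t in
    (-1 : K) ^+ s *:
      apply_op w (seg 1 (n - 2) u ++
        [:: apply_op w (t`_0 :: seg n (2 * n - 2) u);
            apply_op w (seg (2 * n - 1) (3 * n - 2) u)]).

Definition f2 (K : fieldType) (A : lmodType K) (n : nat)
    (w : n.-tuple A -> A) (t : (3 * n - 2).-tuple A) (lambda : K) : A :=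
  F1 w t + lambda *: F2 w t.

(* Main.v *)
Require Import Defs.
From mathcomp Require Import all_boot all_algebra all_fingroup.
From mathcomp Require Import all_order zify.

(** Write [w] for the Lie commutator. Total associativity makes the product of
    [3n-2] elements independent of the bracketing, so both [F1] and [F2] are
    combinations of products of the words obtained by permuting the arguments.
    Choosing a shuffle and then permuting the arguments inside each application
    of [w] amounts to choosing one word [L] cut into three blocks, together with
    the positions [p, q] < [n] at which a block is inserted as a single letter
    into another one. Up to the sign of the word, its coefficient in either sum
    only depends on the position [k] of [t_1]: it is a signed count of the pairs
    [(p, q)] compatible with [k], and an explicit bijection between the two sets
    of compatible pairs preserves the signs. *)

Set Implicit Arguments.
Unset Strict Implicit.
Unset Printing Implicit Defensive.

Import GRing.Theory Order.TTheory Num.Theory.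
Local Open Scope ring_scope.

(** * Signs of words *)

(** The letters of the words are the indices [0], ..., [3n-3] and not the elements of [A]: the
    arguments may coincide, whereas signs and block membership require distinct letters. The
    argument $t_1$ is the letter [0]. In a shuffle, demanding that $t_1$ open the second block means
    that [0] belongs to that block; this condition on a set of letters survives the permutations
    made inside each commutator.

    The coefficient sees only [k] for two reasons. Moving blocks costs a sign determined by their
    lengths, whatever their letters; and after the move, the condition on [0] says that [k] lies in
    intervals fixed by [p] and [q].

    All exponents that remain are multiples of [n+1]: a block of length [n] counts as one letter in
    the sign of the commutator that contains it, but as [n] letters in the sign of the word, so each
    letter it passes contributes [1 + n]. Hence for odd [n] compatible pairs are merely counted, and
    for even [n] the parity of the number of letters passed has to be followed through the
    bijection. *)

Fixpoint ninv (s : seq nat) : nat :=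
  if s is y :: t then (count (gtn y) t + ninv t)%N else 0%N.

Definition cross_ninv (s t : seq nat) : nat := \sum_(y <- s) count (gtn y) t.

Lemma ninv_cat s t : ninv (s ++ t) = (ninv s + cross_ninv s t + ninv t)%N.
Proof.
rewrite /cross_ninv; elim: s => [|y s IH] /=; first by rewrite big_nil.
by rewrite IH big_cons count_cat; lia.
Qed.

Lemma cross_ninv_perm s s' t t' :
  perm_eq s s' -> perm_eq t t' -> cross_ninv s t = cross_ninv s' t'.
Proof.
move=> ss' /seq.permP tt'; rewrite /cross_ninv (perm_big _ ss').
by apply: eq_bigr => y _; apply: tt'.
Qed.

Lemma cross_ninv_catl s s' t :
  cross_ninv (s ++ s') t = (cross_ninv s t + cross_ninv s' t)%N.
Proof. exact: big_cat. Qed.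

Lemma cross_ninv_catr s t t' : cross_ninv s (t ++ t') =
  (cross_ninv s t + cross_ninv s t')%N.
Proof.
by rewrite /cross_ninv -big_split; apply: eq_bigr => y _; rewrite count_cat.
Qed.

(** Two distinct letters are inverted in exactly one of the two orders of the blocks. *)
Lemma cross_ninv_sym s t :
  uniq (s ++ t) -> (cross_ninv s t + cross_ninv t s = size s * size t)%N.
Proof.
rewrite cat_uniq => /and3P[_ dis _]; elim: s dis => [|y s IH] dis.
  by rewrite /cross_ninv big_nil big1_eq mul0n.
have dis' : ~~ has (mem s) t.
  apply: contra dis => /hasP[z zt zs]; apply/hasP; exists z => //.
  by rewrite inE; apply/orP; right.
have yt : y \notin t.
  by apply: contra dis => yt; apply/hasP; exists y; rewrite //= inE eqxx.
rewrite -cat1s cross_ninv_catl cross_ninv_catr addnACA (IH dis') size_cat mulnDl mul1n.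
congr (_ + _)%N.
rewrite /cross_ninv big_seq1; elim: t yt {dis dis' IH} => [|z t IH].
  by rewrite big_nil.
rewrite inE negb_or => /andP[yz yt].
rewrite big_cons /= -(IH yt) /gtn /=; move: (count _ t) (\sum_(_ <- t) _)%N => a b.
by case: ltngtP yz => // _ _ /=; rewrite ?addn0 ?add0n ?add1n ?addSn ?addnS.
Qed.

(** Even corrections are allowed on both sides, so that sign identities become linear equations over
    [nat] without subtraction. *)
Lemma sign_eq (R : pzRingType) (a b c d : nat) :
  (a + c.*2 = b + d.*2)%N -> (-1) ^+ a = (-1) ^+ b :> R.
Proof.
move=> /(congr1 odd); rewrite !oddD !odd_double !addbF => ab.
by rewrite -signr_odd ab signr_odd.
Qed.

Section Sign.
Variable R : pzRingType.
(** A sign by inversions makes sense for every list of naturals, so each block of a word has a sign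
    without renumbering its letters. *)
Definition word_sign (s : seq nat) : R := (-1) ^+ ninv s.

Lemma word_sign_swap (u b c v : seq nat) : uniq (b ++ c) ->
  word_sign (u ++ b ++ c ++ v) =
  (-1) ^+ (size b * size c) * word_sign (u ++ c ++ b ++ v).
Proof.
move=> /cross_ninv_sym bc; rewrite /word_sign -exprD.
apply: (@sign_eq _ _ _ (cross_ninv c b) 0); rewrite -bc !ninv_cat !cross_ninv_catr.
move: (cross_ninv u b) (cross_ninv u c) (cross_ninv u v) => ? ? ?.
move: (cross_ninv b c) (cross_ninv c b) => ? ?.
move: (cross_ninv b v) (cross_ninv c v) => ? ?.
move: (ninv u) (ninv b) (ninv c) (ninv v) => ? ? ? ?.
by clear; lia.
Qed.

Lemma word_sign_sorted s : sorted ltn s -> word_sign s = 1.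
Proof.
suff H : sorted ltn s -> ninv s = 0%N by move=> /H; rewrite /word_sign => ->.
elim: s => //= y s IH; rewrite (path_sortedE ltn_trans) => /andP[ys /IH ->].
rewrite addn0; apply/eqP; rewrite -leqn0 leqNgt -has_count; apply/hasPn => z zs.
by move/allP: ys => /(_ z zs) /= h; rewrite /gtn /= -leqNgt ltnW.
Qed.

(* The sign of a concatenation depends on its factors only through their signs
   and their underlying sets. *)
Lemma word_sign_cat3 (x1 x2 x3 l1 l2 l3 : seq nat) :
  perm_eq l1 x1 -> perm_eq l2 x2 -> perm_eq l3 x3 ->
  word_sign (x1 ++ x2 ++ x3) *
    ((word_sign x1 * word_sign l1) * (word_sign x2 * word_sign l2) *
     (word_sign x3 * word_sign l3)) = word_sign (l1 ++ l2 ++ l3).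
Proof.
move=> p1 p2 p3; rewrite /word_sign -!exprD.
apply: (@sign_eq _ _ _ 0 (ninv x1 + ninv x2 + ninv x3)%N).
rewrite !ninv_cat !cross_ninv_catr.
rewrite (cross_ninv_perm p1 p2) (cross_ninv_perm p1 p3) (cross_ninv_perm p2 p3).
move: (ninv x1) (ninv x2) (ninv x3) (ninv l1) (ninv l2) (ninv l3).
move=> ? ? ? ? ? ?.
by move: (cross_ninv x1 x2) (cross_ninv x1 x3) (cross_ninv x2 x3) => ? ? ?; clear; lia.
Qed.
End Sign.

(** * Permutations as words, and their signs *)

Definition pick_perm (T : Type) (d : T) (m : nat) (x : seq T) (s : 'S_m) : seq T :=
  [seq nth d x (s i) | i <- enum 'I_m].

(* Permuting a word permutes the columns of a Vandermonde matrix, so this relates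
   inversions to the sign of a permutation. *)
Lemma sg_vandermonde (x : seq nat) : uniq x ->
  Num.sg (\prod_(i < size x) \prod_(j < size x | (i < j)%N)
    ((nth 0%N x j)%:Z - (nth 0%N x i)%:Z)) = (-1) ^+ ninv x.
Proof.
elim: x => [|y x IH] /=; first by rewrite big_ord0 sgr1.
case/andP=> yx /IH {}IH; rewrite big_ord_recl sgrM exprD; congr (_ * _).
  rewrite big_mkcond big_ord_recl /= mul1r.
  transitivity (Num.sg (\prod_(z <- x) (z%:Z - y%:Z))).
    by congr Num.sg; rewrite (big_nth 0%N) big_mkord.
  elim: x yx {IH} => [|z x IH]; first by rewrite big_nil sgr1.
  rewrite inE negb_or => /andP[yz yx]; rewrite big_cons sgrM IH //= exprD.
  congr (_ * _); rewrite /gtn /=; case: ltngtP yz => // h _.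
    by rewrite ltr0_sg // subr_lt0 ltz_nat.
  by rewrite gtr0_sg // subr_gt0 ltz_nat.
rewrite -IH; congr Num.sg; apply: eq_bigr => i _.
rewrite big_mkcond big_ord_recl /= mul1r -big_mkcond /=.
by apply: eq_big => // j; rewrite /= /bump /= !add1n.
Qed.

Lemma size_pick_perm (T : Type) (d : T) m (x : seq T) (s : 'S_m) :
  size (pick_perm d x s) = m.
Proof. by rewrite size_map size_enum_ord. Qed.

Lemma nth_pick_perm (T : Type) (d d' : T) m (x : seq T) (s : 'S_m) (i : 'I_m) :
  nth d' (pick_perm d x s) i = nth d x (s i).
Proof. by rewrite (nth_map i) ?size_enum_ord // nth_ord_enum. Qed.

Lemma perm_pick_perm (T : eqType) (d : T) m (x : seq T) (s : 'S_m) :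
  size x = m -> perm_eq (pick_perm d x s) x.
Proof.
move=> sx; have sx' : size x == m by apply/eqP.
apply: (introT (@tuple_permP _ _ _ (Tuple sx'))); exists s.
by apply: eq_map => i; rewrite (tnth_nth d).
Qed.

Lemma ninv_pick_perm m (x : seq nat) (s : 'S_m) : size x = m -> uniq x ->
  odd (ninv (pick_perm 0%N x s)) = (s : bool) (+) odd (ninv x).
Proof.
move=> sx ux.
pose a : 'rV[int]_m := \row_j (nth 0%N x j)%:Z.
pose b : 'rV[int]_m := \row_j (nth 0%N x (s j))%:Z.
have V (c : 'rV[int]_m) (z : seq nat) : size z = m -> uniq z ->
    (forall j : 'I_m, c 0 j = (nth 0%N z j)%:Z) ->
    Num.sg (\det (Vandermonde m c)) = (-1) ^+ ninv z.
  move=> sz uz cz; rewrite -sg_vandermonde // det_Vandermonde sz.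
  by congr Num.sg; apply: eq_bigr => i _; apply: eq_bigr => j _; rewrite !cz.
have Vb : Vandermonde m b = col_perm s (Vandermonde m a).
  by apply/matrixP => i j; rewrite !mxE.
have ue : uniq (pick_perm 0%N x s) by rewrite (perm_uniq (perm_pick_perm _ _ _)).
have sgs : Num.sg ((-1) ^+ s : int) = (-1) ^+ s by case: (s : bool).
have : (-1) ^+ ninv (pick_perm 0%N x s) = (-1) ^+ s * (-1) ^+ ninv x :> int.
  rewrite -(V b) ?size_pick_perm //; last by move=> j; rewrite mxE nth_pick_perm.
  rewrite Vb col_permE det_mulmx sgrM det_perm odd_permV sgs mulrC.
  by rewrite (V a x) // => j; rewrite mxE.
rewrite -signr_odd -[X in _ * X]signr_odd -signr_addb.
exact: signr_inj.
Qed.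

(** * Lie commutators as alternating sums over words *)

Definition ins (T : Type) (p : nat) (y : T) (s : seq T) : seq T :=
  take p s ++ y :: drop p s.

Lemma map_ins (T T' : Type) (f : T -> T') p y s :
  map f (ins p y s) = ins p (f y) (map f s).
Proof. by rewrite /ins map_cat /= map_take map_drop. Qed.

Lemma size_ins (T : Type) p (y : T) s : size (ins p y s) = (size s).+1.
Proof. by rewrite /ins size_cat /= addnS -size_cat cat_take_drop. Qed.

Lemma perm_ins (T : eqType) p (y : T) s : perm_eq (ins p y s) (rcons s y).
Proof.
by rewrite /ins -cat1s perm_catCA /= cat_take_drop perm_sym perm_rcons.
Qed.

Lemma rem_ins (T : eqType) p (y : T) s : y \notin s -> rem y (ins p y s) = s.
Proof.
move=> ys; rewrite /ins remE index_cat.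
have yt : y \notin take p s by apply: contra ys; apply: mem_take.
rewrite (negbTE yt) /= eqxx addn0 take_size_cat // -cat_rcons drop_size_cat.
  by rewrite cat_take_drop.
by rewrite size_rcons.
Qed.

Lemma index_ins (T : eqType) p (y : T) s :
  y \notin s -> (p <= size s)%N -> index y (ins p y s) = p.
Proof.
move=> ys ps; rewrite /ins index_cat.
have yt : y \notin take p s by apply: contra ys; apply: mem_take.
by rewrite (negbTE yt) /= eqxx addn0 size_takel.
Qed.

(** Deleting [y] and recording its index inverts the insertion, so every word arises exactly
    once. *)
Lemma permutations_rcons (T : eqType) (x : seq T) (y : T) :
  uniq x -> y \notin x ->
  perm_eq (permutations (rcons x y))
    [seq ins p y l | l <- permutations x, p <- index_iota 0 (size x).+1].
Proof.
move=> ux yx; have mem_size l : l \in permutations x -> y \notin l /\ size l = size x.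
  by rewrite mem_permutations => lx; rewrite (perm_mem lx) (perm_size lx).
apply: uniq_perm; first exact: permutations_uniq.
  apply: allpairs_uniq; [exact: permutations_uniq|exact: iota_uniq|].
  move=> _ _ /allpairsP[[a b] [al bl ->]] /allpairsP[[a' b'] [al' bl' ->]].
  move: al al' bl bl' => /= al al'; rewrite !mem_index_iota !ltnS /= => bl bl' E.
  have [ya sa] := mem_size _ al; have [ya' sa'] := mem_size _ al'.
  congr (_, _); first by rewrite -(rem_ins b ya) E rem_ins.
  by rewrite -(@index_ins _ b y a) ?sa // E index_ins ?sa'.
move=> L; rewrite mem_permutations; apply/idP/allpairsP => [Lx|].
  have yL : y \in L by rewrite (perm_mem Lx) mem_rcons inE eqxx.
  exists (rem y L, index y L) => /=; split.
  - rewrite mem_permutations -(perm_cons y) -perm_rcons.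
    rewrite (perm_trans _ (perm_trans Lx _)) // ?perm_rcons //.
    by rewrite perm_sym perm_to_rem.
  - rewrite mem_index_iota /= -(size_rcons x y) -(perm_size Lx).
    by rewrite index_mem.
  - rewrite /ins remE take_size_cat ?size_takel ?index_size //.
    rewrite drop_size_cat ?size_takel ?index_size //.
    rewrite -[in LHS](cat_take_drop (index y L) L).
    by rewrite (drop_nth y) ?index_mem // nth_index.
case=> -[l p] /= [lx _ ->]; apply: (perm_trans (perm_ins _ _ _)).
by rewrite !perm_rcons // perm_sym perm_rcons perm_cons perm_sym -mem_permutations.
Qed.

Lemma ninv_rcons_max x M : all (ltn^~ M) x -> ninv (rcons x M) = ninv x.
Proof.
move=> /allP xM; rewrite -cats1 ninv_cat /= !addn0.
rewrite [cross_ninv _ _]big1_seq ?addn0 // => y /= /xM yM.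
by rewrite /gtn /= ltnNge ltnW.
Qed.

Section AlternatingSums.
Variables (K : fieldType) (V : lmodType K).

(** At the end of the word the largest letter creates no inversion; moving it back to position [p]
    creates one for each of the [size x - p] letters passed. *)
Lemma word_sign_ins p M x : uniq x -> all (ltn^~ M) x ->
  word_sign K (ins p M x) = (-1) ^+ (size x - p) * word_sign K x.
Proof.
move=> ux xM; rewrite /ins -size_drop -cat1s -[_ ++ drop p x]cats0 -catA.
rewrite word_sign_swap; last first.
  rewrite /= drop_uniq // andbT.
  by apply/negP => /mem_drop /(allP xM) /=; rewrite ltnn.
rewrite mul1n cats0; congr (_ * _).
by rewrite /word_sign catA cat_take_drop cats1 ninv_rcons_max.
Qed.

Lemma alt_sum_rcons x M (f : seq nat -> V) : uniq x -> all (ltn^~ M) x ->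
  \sum_(L <- permutations (rcons x M)) word_sign K L *: f L =
  \sum_(l <- permutations x) word_sign K l *:
     \sum_(0 <= p < (size x).+1) (-1) ^+ (size x - p) *: f (ins p M l).
Proof.
move=> ux xM.
have Mx : M \notin x by apply/negP => /(allP xM) /=; rewrite ltnn.
rewrite (perm_big _ (permutations_rcons ux Mx)) big_allpairs_dep.
rewrite [LHS]big_seq [RHS]big_seq; apply: eq_bigr => l.
rewrite mem_permutations => lx; rewrite scaler_sumr; apply: eq_bigr => p _.
rewrite word_sign_ins ?(perm_uniq lx) ?(eq_all_r (perm_mem lx)) //.
by rewrite (perm_size lx) scalerA mulrC.
Qed.

(** The factor [word_sign K x] accounts for the inversions already present in [x]: the sign of a
    permutation is the sign of the word it produces relative to that of [x]. *)
Lemma sum_pick_perm m x (f : seq nat -> V) : size x = m -> uniq x ->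
  \sum_(s : 'S_m) (-1 : K) ^+ s *: f (pick_perm 0%N x s) =
  word_sign K x *: \sum_(l <- permutations x) word_sign K l *: f l.
Proof.
move=> sx ux.
have P : perm_eq (permutations x) [seq pick_perm 0%N x s | s <- enum 'S_m].
  apply: uniq_perm; first exact: permutations_uniq.
    rewrite map_inj_uniq ?enum_uniq // => s s' E; apply/permP => i.
    have := nth_pick_perm 0%N 0%N x s i; rewrite E nth_pick_perm => /eqP.
    by rewrite nth_uniq ?sx // => /eqP/ord_inj.
  move=> l; rewrite mem_permutations; apply/idP/mapP => [lx|[s _ ->]]; last first.
    exact: perm_pick_perm.
  have sx' : size x == m by apply/eqP.
  have /tuple_permP[s ls] : perm_eq l (Tuple sx') by [].
  exists s; first by rewrite mem_enum.
  by rewrite ls; apply: eq_map => i; rewrite (tnth_nth 0%N).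
rewrite (perm_big _ P) big_map big_enum scaler_sumr /=.
apply: eq_bigr => s _; rewrite scalerA; congr (_ *: _).
rewrite /word_sign -exprD -signr_odd -[RHS]signr_odd oddD ninv_pick_perm //.
by rewrite addbCA addbb addbF; case: (s : bool).
Qed.

Variables (n : nat) (mu : n.-tuple V -> V).

Lemma lie_commutator_alt (t : nat -> V) x : size x = n -> uniq x ->
  apply_op (lie_commutator mu) (map t x) =
  word_sign K x *: \sum_(l <- permutations x) word_sign K l *: apply_op mu (map t l).
Proof.
move=> sx ux; rewrite -(sum_pick_perm (fun l => apply_op mu (map t l)) sx ux).
apply: eq_bigr => s _; congr (_ *: mu _); apply: eq_from_tnth => i.
rewrite !tnth_mktuple (nth_map 0%N) ?sx // (nth_map 0%N) ?size_pick_perm //.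
by rewrite nth_pick_perm.
Qed.

Lemma eq_map_le (t t' : nat -> V) M s : all (ltn^~ M) s ->
  (forall i, (i < M)%N -> t i = t' i) -> map t s = map t' s.
Proof. by move=> /allP sM tt'; apply/eq_in_map => i /sM /tt'. Qed.

(** The compound argument [y] receives a fresh index [M] above all letters of [x], and [t'] extends
    [t] by sending [M] to [y]; [alt_sum_rcons] then extracts that letter. *)
Lemma lie_commutator_rcons (t : nat -> V) x y : (size x).+1 = n -> uniq x ->
  apply_op (lie_commutator mu) (rcons (map t x) y) =
  word_sign K x *: \sum_(l <- permutations x) word_sign K l *:
    \sum_(0 <= p < n) (-1) ^+ (n.-1 - p) *: apply_op mu (ins p y (map t l)).
Proof.
move=> sx ux; pose M := (\max_(i <- x) i).+1.
have xM : all (ltn^~ M) x by apply/allP => i ix; rewrite /= ltnS leq_bigmax_seq.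
pose t' i := if i == M then y else t i.
have tt' i : (i < M)%N -> t i = t' i by rewrite /t'; case: ltngtP.
have t'M : t' M = y by rewrite /t' eqxx.
rewrite (eq_map_le xM tt') -[X in rcons _ X]t'M -map_rcons lie_commutator_alt.
- rewrite alt_sum_rcons // /word_sign ninv_rcons_max //.
  rewrite sx (congr1 predn sx : size x = _).
  congr (_ *: _).
  rewrite !big_seq; apply: eq_bigr => l; rewrite mem_permutations => lx.
  congr (_ *: _); apply: eq_bigr => p _; rewrite map_ins t'M (eq_map_le _ tt') //.
  by rewrite (eq_all_r (perm_mem lx)).
- by rewrite size_rcons.
rewrite rcons_uniq ux andbT; apply/negP => /(allP xM).
by rewrite /= ltnn.
Qed.

(** Here [z] is extracted while [y] is still an ordinary letter, and [y] afterwards. Hence [p] is a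
    position in a word that already contains [y], and ranges over one value more than [q]. *)
Lemma lie_commutator_rcons2 (t : nat -> V) x y z : (size x).+2 = n -> uniq x ->
  apply_op (lie_commutator mu) (rcons (rcons (map t x) y) z) =
  word_sign K x *: \sum_(l <- permutations x) word_sign K l *:
    \sum_(0 <= q < n.-1) (-1) ^+ (n.-2 - q) *:
      \sum_(0 <= p < n) (-1) ^+ (n.-1 - p) *:
        apply_op mu (ins p z (ins q y (map t l))).
Proof.
move=> sx ux; pose M := (\max_(i <- x) i).+1.
have xM : all (ltn^~ M) x by apply/allP => i ix; rewrite /= ltnS leq_bigmax_seq.
pose t' i := if i == M then y else t i.
have tt' i : (i < M)%N -> t i = t' i by rewrite /t'; case: ltngtP.
have t'M : t' M = y by rewrite /t' eqxx.
rewrite (eq_map_le xM tt') -[X in rcons (rcons _ X)]t'M -map_rcons.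
rewrite lie_commutator_rcons ?size_rcons //; last first.
  rewrite rcons_uniq ux andbT; apply/negP => /(allP xM).
  by rewrite /= ltnn.
rewrite (alt_sum_rcons (fun L => \sum_(0 <= p < n) (-1) ^+ (n.-1 - p) *:
  apply_op mu (ins p z (map t' L)))) // /word_sign ninv_rcons_max //.
rewrite (congr1 predn sx : (size x).+1 = _).
rewrite (congr1 (predn \o predn) sx : size x = _); congr (_ *: _).
rewrite !big_seq; apply: eq_bigr => l; rewrite mem_permutations => lx.
congr (_ *: _); apply: eq_bigr => q _; congr (_ *: _); apply: eq_bigr => p _.
by rewrite map_ins t'M (eq_map_le _ tt') // (eq_all_r (perm_mem lx)).
Qed.

End AlternatingSums.

(** * Products of 3n - 2 factors *)

Lemma segE (T : Type) i j (u v w : seq T) :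
  i.-1 = size u -> j = (size u + size v)%N -> seg i j (u ++ v ++ w) = v.
Proof.
by rewrite /seg => -> ->; rewrite catA -size_cat take_size_cat ?drop_size_cat.
Qed.

Definition insb (T : Type) p (b s : seq T) : seq T := take p s ++ b ++ drop p s.

(* The result of inserting the block [b] as one letter at position [q] of [s],
   and then the block [c] at position [p] of the word so obtained. *)
Definition insb2 (T : Type) p q (b c s : seq T) : seq T :=
  if (p <= q)%N then take p s ++ c ++ drop p (take q s) ++ b ++ drop q s
  else take q s ++ b ++ take (p.-1 - q) (drop q s) ++ c
         ++ drop (p.-1 - q) (drop q s).

Section TotalProduct.
Variables (V : nmodType) (n : nat) (mu : n.-tuple V -> V).
Hypothesis n_ge2 : (2 <= n)%N.
Hypothesis muA : total_associative mu.

Local Notation m := (apply_op mu).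

(** With [prod3], the left-normed bracketing: a normal form to which all other bracketings are
    reduced. *)
Definition prod2 (s : seq V) : V := m (m (take n s) :: drop n s).
Definition prod3 (s : seq V) : V := prod2 (m (take n s) :: drop n s).

Lemma apply_op_assoc l y b z r : (size b).+1 = n -> (size l + size r)%N = n.-2 ->
  m (l ++ m (y :: b) :: z :: r) = m (rcons l y ++ m (rcons b z) :: r).
Proof.
move=> sb slr; pose s := l ++ (y :: b) ++ (z :: r).
have ss : size s == (2 * n - 1)%N by rewrite /s !size_cat /=; lia.
have := muA (i := size l) (Tuple ss) ltac:(lia).
set S1 := seg _ _ _; set S2 := seg _ _ _; set S3 := seg _ _ _.
set S4 := seg _ _ _; set S5 := seg _ _ _; set S6 := seg _ _ _.
have -> : S1 = l by rewrite /S1 /= -[s]cat0s; apply: segE.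
have -> : S2 = y :: b by rewrite /S2 /=; apply: segE => //=; lia.
have -> : S3 = z :: r.
  rewrite /S3 /= -[s]cats0 /s catA -catA; apply: segE; rewrite size_cat /=; lia.
have sE : s = [::] ++ rcons l y ++ b ++ (z :: r) by rewrite cat_rcons.
have sE2 : s = rcons l y ++ rcons b z ++ r by rewrite !cat_rcons.
have -> : S4 = rcons l y.
  by rewrite /S4 /= sE; apply: segE; rewrite //= size_rcons.
have -> : S5 = rcons b z.
  by rewrite /S5 /= sE2; apply: segE; rewrite !size_rcons; lia.
have -> // : S6 = r.
rewrite /S6 /= -[s]cats0 sE2 catA -catA; apply: segE.
  by rewrite size_cat !size_rcons; lia.
by rewrite size_cat !size_rcons; lia.
Qed.

(** The inner bracket slides to the left end one letter at a time: it takes in the last letter of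
    [l] and releases its own last letter to [r]. *)
Lemma prod2E l b r : size b = n -> (size l + size r)%N = n.-1 ->
  m (l ++ m b :: r) = prod2 (l ++ b ++ r).
Proof.
elim/last_ind: l b r => [|l y IH] b r sb.
  by rewrite /prod2 /= take_size_cat ?drop_size_cat.
case/lastP: b sb => [|b z]; rewrite !size_rcons => sb slr.
  by move: n_ge2; rewrite -[X in (_ < X)%N]sb.
rewrite -apply_op_assoc //; last by lia.
by rewrite IH //= ?cat_rcons; last lia.
Qed.

(** The bracket slides as in [prod2E]. For one step, the surrounding product of [2n-1] factors is
    rebracketed so that [y] and the factor [m b] become arguments of the same operation, where
    [apply_op_assoc] applies. *)
Lemma prod3E l b r : size b = n -> (size l + size r)%N = (2 * n - 2)%N ->
  prod2 (l ++ m b :: r) = prod3 (l ++ b ++ r).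
Proof.
elim/last_ind: l b r => [|l y IH] b r sb.
  by rewrite /prod3 /= take_size_cat ?drop_size_cat.
case/lastP: b sb => [|b z]; rewrite !size_rcons => sb slr.
  by move: n_ge2; rewrite -[X in (_ < X)%N]sb.
transitivity (prod2 (l ++ m (y :: b) :: z :: r)); last first.
  by rewrite IH //= ?cat_rcons; last lia.
(* The common operation acts on a window of [n] factors that starts after [p] of them, so [p] is at
   most [n-1]; [k] is the number of factors of the window to the right of [y] and the bracket. *)
pose p := minn (size l) n.-1; pose k := (n - 2 - (size l - p))%N.
have pl : (p <= size l)%N by rewrite /p; lia.
have kr : (k <= size r)%N by rewrite /k /p; lia.
have su : size (take p l) = p by rewrite size_takel.
have sv : size (drop p l) = (size l - p)%N by rewrite size_drop.
have sr1 : size (take k r) = k by rewrite size_takel.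
have sr2 : size (drop k r) = (size r - k)%N by rewrite size_drop.
move: pl kr su sv sr1 sr2 slr (cat_take_drop p l) (cat_take_drop k r).
move: (take p l) (drop p l) (take k r) (drop k r) => u v r1 r2.
move=> pl kr su sv sr1 sr2 slr lE rE.
have sl : size l = (size u + size v)%N by rewrite -size_cat lE.
have sr : size r = (size r1 + size r2)%N by rewrite -size_cat rE.
transitivity (prod2 (u ++ (rcons v y ++ m (rcons b z) :: r1) ++ r2)).
  by rewrite -lE -rE -!cats1 -!catA.
transitivity (prod2 (u ++ (v ++ m (y :: b) :: z :: r1) ++ r2)); last first.
  by rewrite -lE -rE -!catA.
rewrite -!prod2E ?size_cat ?size_rcons /=; try lia.
by rewrite apply_op_assoc //; lia.
Qed.

Lemma prod_nested p q l1 l2 l3 :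
  size l1 = n.-1 -> size l2 = n.-1 -> size l3 = n ->
  m (ins p (m (ins q (m l3) l2)) l1) = prod3 (insb p (insb q l3 l2) l1).
Proof.
move=> s1 s2 s3; rewrite /ins prod2E; first last.
- by rewrite -size_cat cat_take_drop.
- by rewrite -/(ins _ _ _) size_ins; lia.
rewrite !catA -catA /= prod3E //.
  by rewrite /insb -!catA.
have D k (s : seq V) : (size (take k s) + size (drop k s))%N = size s.
  by rewrite -size_cat cat_take_drop.
by rewrite !size_cat; move: (D p l1) (D q l2); lia.
Qed.

Lemma prod_pair p q l1 l2 l3 : (p < n)%N -> (q < n.-1)%N ->
  size l1 = n.-2 -> size l2 = n -> size l3 = n ->
  m (ins p (m l3) (ins q (m l2) l1)) = prod3 (insb2 p q l2 l3 l1).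
Proof.
move=> pn qn s1 s2 s3; rewrite {1}/ins prod2E //; last first.
  by rewrite -size_cat cat_take_drop size_ins; lia.
have sq : size (take q l1) = q by rewrite size_takel; lia.
rewrite /insb2; case: leqP => pq.
  rewrite /ins take_cat drop_cat sq.
  case: (ltnP p q) => [_|qp].
    rewrite take_takel // !catA -!catA /=.
    rewrite -[RHS]/(prod3 (take p l1 ++ l3 ++ drop p (take q l1) ++ l2 ++ drop q l1)).
    rewrite catA catA prod3E //.
      by rewrite -!catA.
    by rewrite !size_cat !size_drop sq size_takel ?s1 ?s3; lia.
  (* For equal positions the later insertion lands just before the earlier one, in agreement with
     the branch [p <= q] of [insb2]. *)
  have -> : p = q by lia.
  rewrite subnn take0 drop0 cats0 [drop q (take q l1)]drop_oversize ?sq //.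
  rewrite catA prod3E ?catA ?cats0 //.
  by rewrite size_cat size_drop sq s1 s3; lia.
rewrite /ins take_cat drop_cat sq ltnNge (ltnW pq) /=.
(* Position [p] counts the letter inserted at [q], hence the shift by one among the original
   letters. *)
have -> : (p - q)%N = (p.-1 - q).+1 by lia.
rewrite /= -catA /= prod3E ?catA //.
have : size (take (p.-1 - q) (drop q l1)) = (p.-1 - q)%N.
  by rewrite size_takel ?size_drop; lia.
by rewrite !size_cat !size_drop sq => ->; lia.
Qed.
End TotalProduct.

(** * Shuffles *)

Section Shuffles.
Variables (a b : nat).
Local Notation b1 := (take a).
Local Notation b2 x := (take b (drop a x)).
Local Notation b3 x := (drop b (drop a x)).

Definition sort_blocks (x : seq nat) : seq nat :=
  sort leq (b1 x) ++ sort leq (b2 x) ++ sort leq (b3 x).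

Definition sorted_blocks (x : seq nat) : bool :=
  [&& sorted ltn (b1 x), sorted ltn (b2 x) & sorted ltn (b3 x)].

Lemma cat_blocks (T : Type) (x : seq T) : b1 x ++ b2 x ++ b3 x = x.
Proof. by rewrite !cat_take_drop. Qed.

Lemma blocks_cat (T : Type) (l1 l2 l3 : seq T) : size l1 = a -> size l2 = b ->
  [/\ b1 (l1 ++ l2 ++ l3) = l1, b2 (l1 ++ l2 ++ l3) = l2
    & b3 (l1 ++ l2 ++ l3) = l3].
Proof.
move=> s1 s2; rewrite take_size_cat // drop_size_cat //.
by rewrite take_size_cat // drop_size_cat.
Qed.

Variable s : seq nat.
Hypothesis size_s : (a + b <= size s)%N.

Lemma size_blocks x : perm_eq x s -> size (b1 x) = a /\ size (b2 x) = b.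
Proof.
move=> xs; have sx : size x = size s by apply: perm_size.
by split; rewrite size_takel ?size_drop ?sx; lia.
Qed.

Hypothesis us : uniq s.

Lemma perm_sort_blocks x : perm_eq (sort_blocks x) x.
Proof.
rewrite -[X in perm_eq _ X]cat_blocks /sort_blocks.
by do 2?[apply: perm_cat]; rewrite perm_sort.
Qed.

Lemma blocks_sort_blocks x : perm_eq x s ->
  [/\ b1 (sort_blocks x) = sort leq (b1 x), b2 (sort_blocks x) = sort leq (b2 x)
    & b3 (sort_blocks x) = sort leq (b3 x)].
Proof.
by move=> /size_blocks [s1 s2]; apply: blocks_cat; rewrite size_sort.
Qed.

Lemma sort_blocks_eq x L : perm_eq x s -> perm_eq L s -> sorted_blocks x ->
  (sort_blocks L == x) =
  [&& perm_eq (b1 L) (b1 x), perm_eq (b2 L) (b2 x) & perm_eq (b3 L) (b3 x)].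
Proof.
move=> xs Ls /and3P[].
rewrite !ltn_sorted_uniq_leq => /andP[_ x1] /andP[_ x2] /andP[_ x3].
have [s1 s2] := size_blocks xs; have [t1 t2] := size_blocks Ls.
rewrite -[X in _ == X]cat_blocks /sort_blocks !eqseq_cat ?size_sort ?s1 ?s2 //.
have E (u v : seq nat) : sorted leq v -> (sort leq u == v) = perm_eq u v.
  move=> sv; rewrite -[X in _ == X](sorted_sort leq_trans sv).
  by apply/eqP/idP => /(perm_sortP leq_total leq_trans anti_leq).
by rewrite !E.
Qed.

Lemma perm_class_blocks x : perm_eq x s -> sorted_blocks x ->
  perm_eq [seq L <- permutations s | sort_blocks L == x]
    [seq l1 ++ l23 | l1 <- permutations (b1 x),
       l23 <- [seq l2 ++ l3 | l2 <- permutations (b2 x),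
                              l3 <- permutations (b3 x)]].
Proof.
move=> xs sx; have [s1 s2] := size_blocks xs.
have inj (x1 : seq nat) (P : seq (seq nat)) : uniq P ->
    uniq [seq l ++ l' | l <- permutations x1, l' <- P].
  move=> uP; apply: allpairs_uniq => //; first exact: permutations_uniq.
  move=> _ _ /allpairsP[[u v] [ul vl ->]] /allpairsP[[u' v'] [ul' vl' ->]] /=.
  move: ul ul'; rewrite !mem_permutations /= => /perm_size su /perm_size su'.
  by move/eqP; rewrite eqseq_cat ?su ?su' // => /andP[/eqP -> /eqP ->].
apply: uniq_perm; first by rewrite filter_uniq // permutations_uniq.
  by apply/inj/inj/permutations_uniq.
move=> L; rewrite mem_filter mem_permutations; apply/andP/allpairsP.
  case=> LE Ls; move: LE; rewrite sort_blocks_eq // => /and3P[L1 L2 L3].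
  exists (b1 L, b2 L ++ b3 L); split; rewrite ?mem_permutations ?cat_blocks //.
  by apply/allpairsP; exists (b2 L, b3 L); split; rewrite ?mem_permutations.
case=> -[l1 l23] [/=]; rewrite mem_permutations => l1x /allpairsP[[l2 l3] [/=]].
rewrite !mem_permutations => l2x l3x -> ->.
have Ls : perm_eq (l1 ++ l2 ++ l3) s.
  by rewrite -(permPr xs) -(cat_blocks x); do 2?[apply: perm_cat].
split=> //; rewrite sort_blocks_eq //.
have [-> -> ->] : [/\ b1 (l1 ++ l2 ++ l3) = l1, b2 (l1 ++ l2 ++ l3) = l2
    & b3 (l1 ++ l2 ++ l3) = l3].
  by apply: blocks_cat; rewrite (perm_size l1x, perm_size l2x).
exact/and3P.
Qed.

Lemma big_pred1_seq (V : nmodType) (I : eqType) (r : seq I) (i : I) (F : I -> V) :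
  uniq r -> i \in r -> \sum_(j <- r | i == j) F j = F i.
Proof.
move=> ur ir; rewrite (big_rem i) //= eqxx big1_seq ?addr0 // => j /andP[/eqP <-].
by rewrite mem_rem_uniqF.
Qed.

Lemma sorted_sort_blocks x : perm_eq x s -> sorted_blocks (sort_blocks x).
Proof.
move=> xs; have [e1 e2 e3] := blocks_sort_blocks xs.
have ux : uniq x by rewrite (perm_uniq xs).
rewrite /sorted_blocks e1 e2 e3 !ltn_sorted_uniq_leq !sort_uniq.
by rewrite !(sort_sorted leq_total) ?take_uniq ?drop_uniq.
Qed.

(** Sorting each block sends a word to a shuffle, and the fibre over a shuffle consists of the
    independent permutations of its three blocks. The condition [Q] is constant on fibres because it
    ignores the order within a block. *)
Lemma sum_shuffles (V : nmodType) (Q : pred (seq nat)) (H : seq nat -> V) :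
  (forall l l' : seq nat, perm_eq l l' -> Q l = Q l') ->
  \sum_(x <- permutations s | sorted_blocks x && Q (b2 x))
    \sum_(l1 <- permutations (b1 x)) \sum_(l2 <- permutations (b2 x))
      \sum_(l3 <- permutations (b3 x)) H (l1 ++ l2 ++ l3) =
  \sum_(L <- permutations s | Q (b2 L)) H L.
Proof.
move=> Qperm.
transitivity (\sum_(x <- permutations s | sorted_blocks x && Q (b2 x))
    \sum_(L <- permutations s | sort_blocks L == x) H L).
  rewrite big_seq_cond [RHS]big_seq_cond; apply: eq_bigr => x.
  rewrite mem_permutations => /andP[xs /andP[sx _]].
  rewrite -[RHS]big_filter (perm_big _ (perm_class_blocks xs sx)) big_allpairs_dep.
  by apply: eq_bigr => l1 _; rewrite big_allpairs_dep.
rewrite (exchange_big_dep xpredT) //= [RHS]big_mkcond big_seq [RHS]big_seq.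
apply: eq_bigr => L; rewrite mem_permutations => Ls.
have srt : perm_eq (sort_blocks L) s by rewrite (permPl (perm_sort_blocks L)).
have QE : Q (b2 (sort_blocks L)) = Q (b2 L).
  by have [_ -> _] := blocks_sort_blocks Ls; apply: Qperm; rewrite perm_sort.
rewrite (eq_bigl (fun x => (sort_blocks L == x) && Q (b2 L))); last first.
  move=> x; rewrite andbC; case: eqP => //= <-.
  by rewrite sorted_sort_blocks.
case: (Q (b2 L)); last by rewrite big1 // => x; rewrite andbF.
rewrite (eq_bigl (fun x => sort_blocks L == x)); last by move=> x; rewrite andbT.
by rewrite big_pred1_seq ?permutations_uniq // mem_permutations.
Qed.

End Shuffles.

(** * Expansion of iterated commutators into alternating sums of products *)

Section Expansion.
Variables (K : fieldType) (V : lmodType K).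

(** The two signs together form the sign of [l] relative to [x], so that [x] may be any block of a
    word, sorted or not. *)
Definition alt (x : seq nat) (f : seq nat -> V) : V :=
  \sum_(l <- permutations x) (word_sign K x * word_sign K l) *: f l.

Lemma altE x f :
  alt x f = word_sign K x *: \sum_(l <- permutations x) word_sign K l *: f l.
Proof. by rewrite scaler_sumr; apply: eq_bigr => l _; rewrite scalerA. Qed.

Lemma eq_alt x f g : (forall l, perm_eq l x -> f l = g l) -> alt x f = alt x g.
Proof.
move=> fg; rewrite /alt !big_seq; apply: eq_bigr => l.
by rewrite mem_permutations => /fg ->.
Qed.

Lemma alt_sum (I : Type) (r : seq I) (c : I -> K) (f : I -> seq nat -> V) x :
  alt x (fun l => \sum_(i <- r) c i *: f i l) = \sum_(i <- r) c i *: alt x (f i).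
Proof.
rewrite /alt; under eq_bigr => l _ do rewrite scaler_sumr.
rewrite exchange_big; apply: eq_bigr => i _; rewrite scaler_sumr.
by apply: eq_bigr => l _; rewrite !scalerA mulrC.
Qed.

Lemma linear_sum_scale (g : V -> V) (I : Type) (r : seq I) (c : I -> K) (f : I -> V) :
  (forall c u v, g (c *: u + v) = c *: g u + g v) ->
  g (\sum_(i <- r) c i *: f i) = \sum_(i <- r) c i *: g (f i).
Proof.
move=> lin; elim: r => [|i r IH]; last by rewrite !big_cons lin IH.
by rewrite !big_nil; have := lin (-1) 0 0; rewrite scaler0 addr0 scaleN1r addNr.
Qed.

Lemma linear_alt (g : V -> V) x f :
  (forall c u v, g (c *: u + v) = c *: g u + g v) ->
  g (alt x f) = alt x (fun l => g (f l)).
Proof. exact: linear_sum_scale. Qed.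

(** By [word_sign_cat3], the sign of the shuffle times the three relative signs of the blocks is the
    sign of the whole word; [sum_shuffles] then merges the four sums. *)
Lemma alt_shuffles a b s (Q : pred (seq nat)) (G : seq nat -> seq nat -> seq nat -> V) :
  uniq s -> (a + b <= size s)%N ->
  (forall l l' : seq nat, perm_eq l l' -> Q l = Q l') ->
  \sum_(x <- permutations s | sorted_blocks a b x && Q (take b (drop a x)))
    word_sign K x *: alt (take a x) (fun l1 => alt (take b (drop a x)) (fun l2 =>
      alt (drop b (drop a x)) (fun l3 => G l1 l2 l3))) =
  \sum_(L <- permutations s | Q (take b (drop a L)))
    word_sign K L *: G (take a L) (take b (drop a L)) (drop b (drop a L)).
Proof.
move=> us ss Qp; rewrite -(sum_shuffles ss us _ Qp).
rewrite big_seq_cond [RHS]big_seq_cond; apply: eq_bigr => x.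
rewrite mem_permutations => /andP[xs _]; have [s1 s2] := size_blocks ss xs.
rewrite scaler_sumr big_seq [RHS]big_seq; apply: eq_bigr => l1.
rewrite mem_permutations => p1; rewrite !scaler_sumr big_seq [RHS]big_seq.
apply: eq_bigr => l2; rewrite mem_permutations => p2.
rewrite !scaler_sumr big_seq [RHS]big_seq.
apply: eq_bigr => l3; rewrite mem_permutations => p3.
have [] := @blocks_cat a b _ l1 l2 l3; rewrite ?(perm_size p1) ?(perm_size p2) //.
move=> -> -> ->; rewrite -(word_sign_cat3 K p1 p2 p3) cat_blocks !scalerA.
by congr (_ *: _); rewrite -!mulrA.
Qed.

Variables (n : nat) (mu : n.-tuple V -> V).
Hypothesis n_ge2 : (2 <= n)%N.
Hypothesis mu_lin : is_multilinear mu.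
Hypothesis muA : total_associative mu.

Local Notation m := (apply_op mu).
Local Notation w := (apply_op (lie_commutator mu)).
Local Notation prod3 := (prod3 mu).

Lemma apply_op_linear (u v : seq V) : (size u + size v)%N = n.-1 ->
  forall c y z, m (u ++ (c *: y + z) :: v) = c *: m (u ++ y :: v) + m (u ++ z :: v).
Proof.
move=> suv c y z; have un : (size u < n)%N by lia.
pose a : n.-tuple V := [tuple (u ++ 0 :: v)`_j | j < n].
have E x : m (u ++ x :: v) =
    mu [tuple if j == Ordinal un then x else tnth a j | j < n].
  congr mu; apply: eq_from_tnth => j; rewrite !tnth_mktuple !nth_cat -val_eqE /=.
  case: ltngtP => // [ju|->]; last by rewrite subnn.
  by rewrite -(subnSK ju).
by rewrite !E mu_lin.
Qed.

Lemma ins_linear p s : size s = n.-1 ->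
  forall c y z, m (ins p (c *: y + z) s) = c *: m (ins p y s) + m (ins p z s).
Proof.
move=> ss; apply: apply_op_linear; by rewrite -size_cat cat_take_drop.
Qed.

(** The place of [y] in the final word does not depend on [y], so linearity in [y] reduces to
    linearity in one fixed argument. *)
Lemma ins_ins_cat (T : Type) p q (z : T) s : (q <= size s)%N ->
  exists u v, forall y, ins p z (ins q y s) = u ++ y :: v.
Proof.
move=> qs; have sq : size (take q s) = q by rewrite size_takel.
case: (leqP p q) => pq.
  exists (take p s ++ z :: drop p (take q s)), (drop q s) => y.
  rewrite /ins take_cat drop_cat sq -catA /=; case: (ltnP p q) => [_|qp].
    by rewrite take_takel.
  have -> : p = q by lia.
  by rewrite subnn take0 drop0 cats0 [drop q (take q s)]drop_oversize ?sq.
exists (take q s), (take (p - q).-1 (drop q s) ++ z :: drop (p - q).-1 (drop q s)).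
move=> y; rewrite /ins take_cat drop_cat sq ltnNge (ltnW pq) /=.
have -> : (p - q)%N = (p - q).-1.+1 by lia.
by rewrite -catA.
Qed.

Lemma ins2_linear p q v s : (q < n.-1)%N -> size s = n.-2 ->
  forall c y z, m (ins p v (ins q (c *: y + z) s)) =
    c *: m (ins p v (ins q y s)) + m (ins p v (ins q z s)).
Proof.
move=> qn ss c y z.
have [|u [u' E]] := @ins_ins_cat V p q v s; first by rewrite ss; lia.
rewrite !E apply_op_linear //.
have := congr1 size (E 0); rewrite !size_ins size_cat /= ss.
by move: (size u) (size u') => ? ?; lia.
Qed.

Lemma map_insb (T T' : Type) (f : T -> T') p u s :
  map f (insb p u s) = insb p (map f u) (map f s).
Proof. by rewrite /insb !map_cat map_take map_drop. Qed.

Lemma map_insb2 (T T' : Type) (f : T -> T') p q u v s :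
  map f (insb2 p q u v s) = insb2 p q (map f u) (map f v) (map f s).
Proof. by rewrite /insb2; case: ifP => _; rewrite !(map_cat, map_take, map_drop). Qed.

(** Multilinearity brings the inner alternating sums outside all products. The sums over [p] and [q]
    are kept outermost because words will be rearranged separately for each pair. *)
Lemma expand_nested (t : nat -> V) x1 x2 x3 :
  size x1 = n.-1 -> size x2 = n.-1 -> size x3 = n ->
  uniq x1 -> uniq x2 -> uniq x3 ->
  w (rcons (map t x1) (w (rcons (map t x2) (w (map t x3))))) =
  \sum_(0 <= p < n) (-1) ^+ (n.-1 - p) *: \sum_(0 <= q < n) (-1) ^+ (n.-1 - q) *:
    alt x1 (fun l1 => alt x2 (fun l2 => alt x3 (fun l3 =>
      prod3 (map t (insb p (insb q l3 l2) l1))))).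
Proof.
move=> s1 s2 s3 u1 u2 u3.
rewrite lie_commutator_rcons ?s1 //; last lia.
rewrite -altE alt_sum; apply: eq_bigr => p _; congr (_ *: _).
rewrite -alt_sum; apply: eq_alt => l1 p1.
have t1 : size (map t l1) = n.-1 by rewrite size_map (perm_size p1).
rewrite lie_commutator_rcons ?s2 //; last lia.
rewrite -altE (linear_alt _ _ (ins_linear p t1)) -alt_sum.
apply: eq_alt => l2 p2; rewrite lie_commutator_alt // -altE.
have t2 : size (map t l2) = n.-1 by rewrite size_map (perm_size p2).
rewrite (linear_sum_scale _ _ _ (ins_linear p t1)); apply: eq_bigr => q _.
rewrite (linear_alt _ _ (ins_linear q t2)) (linear_alt _ _ (ins_linear p t1)).
congr (_ *: _); apply: eq_alt => l3 p3.
by rewrite prod_nested ?map_insb // size_map (perm_size p3).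
Qed.

Lemma expand_pair (t : nat -> V) x1 x2 x3 :
  size x1 = n.-2 -> size x2 = n -> size x3 = n ->
  uniq x1 -> uniq x2 -> uniq x3 ->
  w (rcons (rcons (map t x1) (w (map t x2))) (w (map t x3))) =
  \sum_(0 <= q < n.-1) (-1) ^+ (n.-2 - q) *: \sum_(0 <= p < n) (-1) ^+ (n.-1 - p) *:
    alt x1 (fun l1 => alt x2 (fun l2 => alt x3 (fun l3 =>
      prod3 (map t (insb2 p q l2 l3 l1))))).
Proof.
move=> s1 s2 s3 u1 u2 u3.
rewrite lie_commutator_rcons2 ?s1 //; last lia.
rewrite -altE alt_sum; apply: eq_big_nat => q /andP[_ qn]; congr (_ *: _).
rewrite alt_sum; apply: eq_big_nat => p /andP[_ pn]; congr (_ *: _).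
apply: eq_alt => l1 p1.
have t1 : size (map t l1) = n.-2 by rewrite size_map (perm_size p1).
rewrite (lie_commutator_alt _ _ s2) // (lie_commutator_alt _ _ s3) // -!altE.
rewrite (linear_alt _ _ (ins2_linear p _ qn t1)); apply: eq_alt => l2 p2.
have t2 : size (ins q (m (map t l2)) (map t l1)) = n.-1 by rewrite size_ins t1; lia.
rewrite (linear_alt _ _ (ins_linear p t2)); apply: eq_alt => l3 p3.
by rewrite prod_pair ?map_insb2 // size_map (perm_size p2, perm_size p3).
Qed.
End Expansion.

(** * [F1] and [F2] as sums over words *)

Lemma seg_map (T T' : Type) (f : T -> T') i j s :
  seg i j (map f s) = map f (seg i j s).
Proof. by rewrite /seg map_drop map_take. Qed.

Lemma seg_behead (T : Type) i j (s : seq T) :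
  (0 < i)%N -> seg i.+1 j s = behead (seg i j s).
Proof. by case: i => // i _; rewrite /seg /= -drop1 drop_drop. Qed.

Lemma seg_blocks (T : Type) (a b : nat) (s : seq T) :
  [/\ seg 1 a s = take a s, seg a.+1 (a + b) s = take b (drop a s)
    & seg (a + b).+1 (size s) s = drop b (drop a s)].
Proof.
rewrite /seg /= drop0 take_size drop_drop [(b + a)%N]addnC take_drop.
by rewrite [(b + a)%N]addnC.
Qed.

(** The smallest letter can only open an increasing block. This replaces the condition on the first
    entry of a block by one on its set of letters, as [sum_shuffles] requires. *)
Lemma mem0_sorted (s : seq nat) :
  sorted ltn s -> (0 < size s)%N -> (0%N \in s) = (nth 0%N s 0 == 0%N).
Proof.
case: s => //= y s; rewrite (path_sortedE ltn_trans) => /andP[/allP ys _] _.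
rewrite inE eq_sym; case: eqP => //= /eqP y0; apply/negP => /ys.
by rewrite ltn0.
Qed.

Lemma oneline_pick m (s : 'S_m) :
  oneline s = map S (pick_perm 0%N (iota 0 m) s).
Proof.
by rewrite /oneline /pick_perm -map_comp; apply: eq_map => i /=; rewrite nth_iota.
Qed.

Lemma permute_pick (V : nmodType) m (a : m.-tuple V) (s : 'S_m) :
  permute s a = map (nth 0 a) (pick_perm 0%N (iota 0 m) s) :> seq V.
Proof.
rewrite /= /pick_perm -map_comp; apply: eq_map => i /=.
by rewrite nth_iota // (tnth_nth 0).
Qed.

Lemma increasing_on_pick m (s : 'S_m) i j :
  increasing_on s i j = sorted ltn (seg i j (pick_perm 0%N (iota 0 m) s)).
Proof. by rewrite /increasing_on oneline_pick seg_map sorted_map. Qed.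

Lemma perm_at_pick m (s : 'S_m) i : (i.-1 < m)%N ->
  perm_at s i = (nth 0%N (pick_perm 0%N (iota 0 m) s) i.-1).+1.
Proof.
by move=> im; rewrite /perm_at oneline_pick (nth_map 0%N) // size_pick_perm.
Qed.

Section Words.
Variables (K : fieldType) (V : lmodType K).
Variables (n : nat) (mu : n.-tuple V -> V).
Hypothesis n_ge2 : (2 <= n)%N.
Variable a : (3 * n - 2).-tuple V.

Local Notation w := (apply_op (lie_commutator mu)).
Local Notation N := (3 * n - 2)%N.
Local Notation tv := (nth 0 a).
Local Notation prod3 := (prod3 mu).
Local Notation words := (permutations (iota 0 N)).

Lemma sum_perm_words (P : pred 'S_N) (C : pred (seq nat)) (f : 'S_N -> V)
    (g : seq nat -> V) :
  (forall s, P s = C (pick_perm 0%N (iota 0 N) s)) ->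
  (forall s, P s -> f s = g (pick_perm 0%N (iota 0 N) s)) ->
  \sum_(s | P s) (-1 : K) ^+ s *: f s = \sum_(x <- words | C x) word_sign K x *: g x.
Proof.
move=> PC fg; rewrite big_mkcond [RHS]big_mkcond.
pose h x := if C x then g x else 0.
transitivity (\sum_(s : 'S_N) (-1 : K) ^+ s *: h (pick_perm 0%N (iota 0 N) s)).
  apply: eq_bigr => s _; rewrite /h -PC; case: ifP => [/fg -> //|_].
  by rewrite scaler0.
rewrite sum_pick_perm ?size_iota ?iota_uniq // word_sign_sorted ?iota_ltn_sorted //.
rewrite scale1r; apply: eq_bigr => x _; rewrite /h; case: ifP => // _.
by rewrite scaler0.
Qed.

Lemma segs1 (T : Type) (x : seq T) : size x = N ->
  [/\ seg 1 (n - 1) x = take n.-1 x, seg n (2 * n - 2) x = take n.-1 (drop n.-1 x)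
    & seg (2 * n - 1) N x = drop n.-1 (drop n.-1 x)].
Proof.
move=> sx; have [<- <- <-] := seg_blocks n.-1 n.-1 x.
by split; [congr seg|congr seg|rewrite sx; congr seg]; lia.
Qed.

Lemma segs2 (T : Type) (x : seq T) : size x = N ->
  [/\ seg 1 (n - 2) x = take n.-2 x,
      seg (n - 1) (2 * n - 2) x = take n (drop n.-2 x)
    & seg (2 * n - 1) N x = drop n (drop n.-2 x)].
Proof.
move=> sx; have [<- <- <-] := seg_blocks n.-2 n x.
by split; [congr seg|congr seg|rewrite sx; congr seg]; lia.
Qed.

Lemma F1_words : F1 (lie_commutator mu) a =
  \sum_(x <- words | sorted_blocks n.-1 n.-1 x
                     && (0%N \in take n.-1 (drop n.-1 x)))
    word_sign K x *: w (rcons (map tv (take n.-1 x))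
      (w (rcons (map tv (take n.-1 (drop n.-1 x)))
         (w (map tv (drop n.-1 (drop n.-1 x))))))).
Proof.
have C s : (s \in shuffle1 n) && (perm_at s n == 1%N) =
    (let x := pick_perm 0%N (iota 0 N) s in sorted_blocks n.-1 n.-1 x
       && (0%N \in take n.-1 (drop n.-1 x))).
  set x := pick_perm _ _ s; have sx : size x = N by apply: size_pick_perm.
  have [S1 S2 S3] := segs1 sx; rewrite inE !increasing_on_pick -/x S1 S2 S3.
  rewrite perm_at_pick -/x; last lia.
  rewrite /sorted_blocks -!andbA; congr (_ && _).
  have [so|//] := boolP (sorted ltn (take _ _)); congr (_ && _).
  by rewrite mem0_sorted ?nth_take ?nth_drop ?addn0 // ?size_takel ?size_drop ?sx; lia.
apply: sum_perm_words => // s; rewrite C; set x := pick_perm _ _ s.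
have sx : size x = N by apply: size_pick_perm.
have [S1 S2 S3] := segs1 sx; rewrite permute_pick /= -/x; clearbody x.
rewrite !seg_map.
rewrite addn1 [seg n.+1 _ x]seg_behead ?S1 ?S2 ?S3; last lia.
case/andP=> /and3P[_ so _]; have : (0 < size (take n.-1 (drop n.-1 x)))%N.
  by rewrite size_takel ?size_drop ?sx; lia.
move: so; case: (take _ (drop _ x)) => [//|y y2] so _.
(* The first letter [y] of the block is [0], so the argument $t_1$ written separately in [F1] is the
   image of that letter. *)
by rewrite mem0_sorted //= => /eqP ->; rewrite !cats1.
Qed.

Lemma F2_words : F2 (lie_commutator mu) a =
  \sum_(x <- words | sorted_blocks n.-2 n x && (0%N \in take n (drop n.-2 x)))
    word_sign K x *: w (rcons (rcons (map tv (take n.-2 x))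
      (w (map tv (take n (drop n.-2 x))))) (w (map tv (drop n (drop n.-2 x))))).
Proof.
have C s : (s \in shuffle2 n) && (perm_at s (n - 1) == 1%N) =
    (let x := pick_perm 0%N (iota 0 N) s in sorted_blocks n.-2 n x
       && (0%N \in take n (drop n.-2 x))).
  set x := pick_perm _ _ s; have sx : size x = N by apply: size_pick_perm.
  have ux : uniq x by rewrite (perm_uniq (perm_pick_perm _ _ _)) ?size_iota ?iota_uniq.
  have [S1 S2 S3] := segs2 sx; rewrite inE !increasing_on_pick -/x S1 S2 S3.
  rewrite !perm_at_pick -/x; try lia.
  rewrite /sorted_blocks -!andbA; congr (_ && _).
  have [so|//] := boolP (sorted ltn (take _ _)); congr (_ && _).
  rewrite mem0_sorted ?nth_take ?nth_drop ?addn0 // ?size_takel ?size_drop ?sx; try lia.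
  have -> : (n - 1).-1 = n.-2 by lia.
  (* Once [0] opens the second block, distinctness of the letters gives the inequality between the
     first letters of the last two blocks. *)
  rewrite eqSS; case: eqP => [x0|_]; rewrite ?andbF // x0 andbT ltnS lt0n.
  by rewrite -[X in _ != X]x0 nth_uniq ?sx; lia.
apply: sum_perm_words => // s; rewrite C; set x := pick_perm _ _ s.
have sx : size x = N by apply: size_pick_perm.
have [S1 S2 S3] := segs2 sx; rewrite permute_pick /= -/x; clearbody x.
rewrite !seg_map.
have -> : seg n (2 * n - 2) x = behead (take n (drop n.-2 x)).
  rewrite -S2 -seg_behead; last lia.
  by congr seg; lia.
rewrite S1 S3; case/andP=> /and3P[_ so _]; have : (0 < size (take n (drop n.-2 x)))%N.
  by rewrite size_takel ?size_drop ?sx; lia.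
move: so; case: (take n _) => [//|y y2] so _.
by rewrite mem0_sorted //= => /eqP ->; rewrite -!cats1 -catA.
Qed.
End Words.

(** * Rearranging words *)

Lemma index_mid (T : eqType) (x : T) (s t v : seq T) : uniq (s ++ t) ->
  (x \in t) = (size s <= index x (s ++ t ++ v) < size s + size t)%N.
Proof.
rewrite cat_uniq => /and3P[_ dis _]; rewrite index_cat.
have [xs|xs] := boolP (x \in s).
  rewrite leqNgt index_mem xs /=; apply/negP => xt.
  by case/negP: dis; apply/hasP; exists x.
rewrite leq_addr ltn_add2l index_cat; have [xt|xt] := boolP (x \in t).
  by rewrite index_mem xt.
by rewrite ltnNge leq_addr.
Qed.

Lemma uniq_catl (T : eqType) (s t : seq T) : uniq (s ++ t) -> uniq s.
Proof. by rewrite cat_uniq => /andP[]. Qed.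

Lemma uniq_catr (T : eqType) (s t : seq T) : uniq (s ++ t) -> uniq t.
Proof. by rewrite cat_uniq => /and3P[]. Qed.

Lemma exchange_scale (K : fieldType) (V : lmodType K) (I J : Type) (r : seq I)
    (r' : seq J) (P : pred I) (Q : pred J) (c : I -> K) (d : J -> K) (f : I -> J -> V) :
  \sum_(i <- r | P i) c i *: (\sum_(j <- r' | Q j) d j *: f i j) =
  \sum_(j <- r' | Q j) d j *: (\sum_(i <- r | P i) c i *: f i j).
Proof.
under eq_bigr => i _ do rewrite scaler_sumr.
rewrite exchange_big; apply: eq_bigr => j _; rewrite scaler_sumr.
by apply: eq_bigr => i _; rewrite !scalerA mulrC.
Qed.

(* A rearrangement that commutes with relabelling acts on positions, hence
   permutes the words. *)
Lemma reindex_words (V : nmodType) N (r : seq nat -> seq nat) (P : pred (seq nat))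
    (F : seq nat -> V) :
  (forall (f : nat -> nat) s, r (map f s) = map f (r s)) ->
  (forall s, size s = N -> perm_eq (r s) s) ->
  \sum_(L <- permutations (iota 0 N) | P (r L)) F (r L) =
  \sum_(W <- permutations (iota 0 N) | P W) F W.
Proof.
move=> rmap rperm; rewrite -[LHS](big_map r P); apply: perm_big.
have sz L : L \in permutations (iota 0 N) -> size L = N.
  by rewrite mem_permutations => /perm_size ->; rewrite size_iota.
have inj : {in permutations (iota 0 N) &, injective r}.
  move=> L L' /sz sL /sz sL' E; have iL (M : seq nat) : size M = N ->
      r M = map (nth 0%N M) (r (iota 0 N)).
    by move=> sM; rewrite -rmap -[in LHS](mkseq_nth 0%N M) sM.
  move: E; rewrite (iL L) // (iL L') // => E.
  apply: (@eq_from_nth _ 0%N); rewrite ?sL // => i iN.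
  move/eq_in_map: E; apply.
  by rewrite (perm_mem (rperm _ (size_iota _ _))) mem_iota.
have um : uniq (map r (permutations (iota 0 N))).
  by rewrite map_inj_in_uniq ?permutations_uniq.
have sub : {subset map r (permutations (iota 0 N)) <= permutations (iota 0 N)}.
  move=> _ /mapP[L Lp ->]; have sL := sz _ Lp; move: Lp.
  by rewrite !mem_permutations; apply/perm_trans/rperm.
apply: uniq_perm => //; first exact: permutations_uniq.
have [|//] := uniq_min_size um sub; by rewrite size_map.
Qed.

Section Reindexing.
Variable n : nat.
Hypothesis n_ge2 : (2 <= n)%N.
Local Notation N := (3 * n - 2)%N.

(** [L] lists the three blocks one after another; the result has its letters in the order in which
    they are multiplied. *)
Definition nested_word p q (L : seq nat) : seq nat :=
  insb p (insb q (drop n.-1 (drop n.-1 L)) (take n.-1 (drop n.-1 L)))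
    (take n.-1 L).

Definition pair_word p q (L : seq nat) : seq nat :=
  insb2 p q (take n (drop n.-2 L)) (drop n (drop n.-2 L)) (take n.-2 L).

(** The innermost block, of length [n], cuts the second block into pieces of lengths [q] and
    [n-1-q]; the two intervals are the places of these pieces in the word. *)
Definition nested_pos p q k : bool :=
  (p <= k < p + q)%N || (p + q + n <= k < p + n + n.-1)%N.

(** For [p <= q] the third block precedes the second one and shifts it by [n] places. *)
Definition pair_pos p q k : bool :=
  if (p <= q)%N then (q + n <= k < q + n + n)%N else (q <= k < q + n)%N.

Lemma perm_insb (T : eqType) p (u s : seq T) : perm_eq (insb p u s) (s ++ u).
Proof. by rewrite /insb perm_catCA cat_take_drop perm_catC. Qed.

Lemma perm_insb2 (T : eqType) p q (u v s : seq T) :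
  perm_eq (insb2 p q u v s) (s ++ u ++ v).
Proof.
apply/seq.permP => P; rewrite /insb2; case: leqP => pq; rewrite !count_cat.
  rewrite -[in RHS](cat_take_drop q s) -[in RHS](cat_take_drop p (take q s)).
  by rewrite take_takel // !count_cat; lia.
rewrite -[in RHS](cat_take_drop q s).
by rewrite -[in RHS](cat_take_drop (p.-1 - q) (drop q s)) !count_cat; lia.
Qed.

Lemma perm_nested_word p q L : perm_eq (nested_word p q L) L.
Proof.
rewrite /nested_word (permPl (perm_insb _ _ _)) -[X in perm_eq _ X](cat_take_drop n.-1).
rewrite perm_cat2l (permPl (perm_insb _ _ _)).
by rewrite -[X in perm_eq _ X](cat_take_drop n.-1).
Qed.

Lemma perm_pair_word p q L : perm_eq (pair_word p q L) L.
Proof. by rewrite /pair_word (permPl (perm_insb2 _ _ _ _ _)) !cat_take_drop. Qed.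

Lemma map_nested_word p q (f : nat -> nat) s :
  nested_word p q (map f s) = map f (nested_word p q s).
Proof. by rewrite /nested_word !map_insb !(map_take, map_drop). Qed.

Lemma map_pair_word p q (f : nat -> nat) s :
  pair_word p q (map f s) = map f (pair_word p q s).
Proof. by rewrite /pair_word map_insb2 !(map_take, map_drop). Qed.

Lemma nested_word_cat p q u v c1 c2 c : size u = p -> size c1 = q ->
  size (u ++ v) = n.-1 -> size (c1 ++ c2) = n.-1 ->
  nested_word p q (u ++ v ++ c1 ++ c2 ++ c) = u ++ c1 ++ c ++ c2 ++ v.
Proof.
move=> su sc1 suv sc; rewrite /nested_word catA [c1 ++ _]catA.
rewrite !(drop_size_cat _ suv) !(take_size_cat _ suv).
rewrite (drop_size_cat _ sc) (take_size_cat _ sc) /insb.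
by rewrite !drop_size_cat // !take_size_cat // -!catA.
Qed.

Lemma nested_split p q (L : seq nat) : (p < n)%N -> (q < n)%N -> size L = N ->
  exists u v c1 c2 c, [/\ L = u ++ v ++ c1 ++ c2 ++ c, size u = p, size c1 = q &
    [/\ size (u ++ v) = n.-1, size (c1 ++ c2) = n.-1 & size c = n]].
Proof.
move=> pn qn sL; pose L1 := take n.-1 L; pose L2 := take n.-1 (drop n.-1 L).
pose L3 := drop n.-1 (drop n.-1 L).
have s1 : size L1 = n.-1 by rewrite size_takel ?sL; lia.
have s2 : size L2 = n.-1 by rewrite size_takel ?size_drop ?sL; lia.
exists (take p L1), (drop p L1), (take q L2), (drop q L2), L3.
split.
- rewrite !catA cat_take_drop -(catA L1) cat_take_drop -catA.
  by rewrite !cat_take_drop.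
- by rewrite size_takel ?s1; lia.
- by rewrite size_takel ?s2; lia.
by rewrite !cat_take_drop s1 s2 !size_drop sL; split => //; lia.
Qed.

Lemma nested_posE p q L : (p < n)%N -> (q < n)%N -> size L = N -> uniq L ->
  (0%N \in take n.-1 (drop n.-1 L)) = nested_pos p q (index 0%N (nested_word p q L)).
Proof.
move=> pn qn sL; rewrite -(perm_uniq (perm_nested_word p q L)).
have [u [v [c1 [c2 [c [-> su s1 [suv s12 sc]]]]]]] := nested_split pn qn sL.
rewrite nested_word_cat // => uW.
rewrite [in LHS]catA (drop_size_cat _ suv) [c1 ++ _]catA (take_size_cat _ s12).
rewrite mem_cat /nested_pos; congr (_ || _).
  rewrite (@index_mid _ _ u c1 (c ++ c2 ++ v)) ?su ?s1 //.
  by move: uW; rewrite catA => /uniq_catl.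
rewrite (@index_mid _ _ (u ++ c1 ++ c) c2 v); last first.
  by move: uW; rewrite !catA => /uniq_catl.
have s2 : size c2 = (n.-1 - q)%N by move: s12; rewrite size_cat s1; lia.
rewrite -!catA !size_cat su s1 sc s2; move: (index _ _) => k.
by congr (_ <= _ < _)%N; lia.
Qed.

Variable R : comPzRingType.

(** The word is obtained by moving [c2] past [c] and then [v] past [2n-1] letters. The latter number
    is odd, so this move cancels the sign in [n-1-p]; the former costs [n] for each of the [n-1-q]
    letters of [c2], which combines with the sign in [n-1-q]. *)
Lemma nested_word_sign p q L : (p < n)%N -> (q < n)%N -> size L = N -> uniq L ->
  (-1) ^+ (n.-1 - p) * ((-1) ^+ (n.-1 - q) * word_sign R L) =
  (-1) ^+ (n.+1 * (n.-1 - q)) * word_sign R (nested_word p q L).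
Proof.
move=> pn qn sL uL.
have [u [v [c1 [c2 [c [LE su s1 [suv s12 sc]]]]]]] := nested_split pn qn sL.
move: uL; rewrite LE nested_word_cat // => uL.
have uM : uniq (v ++ c1 ++ c2 ++ c) := uniq_catr uL.
have uc : uniq (c2 ++ c) := uniq_catr (uniq_catr uM).
have uM' : uniq (v ++ (c1 ++ c ++ c2)).
  by rewrite -(perm_uniq (_ : perm_eq (v ++ c1 ++ c2 ++ c) _)) // !perm_cat2l perm_catC.
have := word_sign_swap R (u ++ v ++ c1) [::] uc; rewrite !cats0 -!catA => ->.
have := word_sign_swap R u [::] uM'; rewrite !cats0 -!catA => ->.
rewrite !mulrA; congr (_ * _); rewrite -!exprD.
have sv : size v = (n.-1 - p)%N by move: suv; rewrite size_cat su; lia.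
have s2 : size c2 = (n.-1 - q)%N by move: s12; rewrite size_cat s1; lia.
rewrite !size_cat sv s1 sc s2; move: (n.-1 - p)%N => x.
have -> : (q + (n + (n.-1 - q)) = (2 * n).-1)%N by lia.
move: (n.-1 - q)%N => y; rewrite -signr_odd -[RHS]signr_odd.
congr (_ ^+ (nat_of_bool _)).
have -> : (2 * n).-1 = (2 * n.-1).+1 by lia.
rewrite !(oddD, oddM, oddS).
by case: (odd n); case: (odd x); case: (odd y).
Qed.

Lemma pair_split p q (L : seq nat) : (p < n)%N -> (q < n.-1)%N -> size L = N ->
  exists x1 x2 x3 b c, [/\ L = x1 ++ x2 ++ x3 ++ b ++ c,
    size (x1 ++ x2 ++ x3) = n.-2, size b = n, size c = n &
    if (p <= q)%N then size x1 = p /\ size (x1 ++ x2) = q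
    else size x1 = q /\ size (x1 ++ x2) = p.-1].
Proof.
move=> pn qn sL; pose L1 := take n.-2 L.
have s1 : size L1 = n.-2 by rewrite size_takel ?sL; lia.
(* These are the two cut points of the first block; if [q < p], the position [p] also counts the
   letter inserted at [q], hence [p.-1]. *)
pose i := if (p <= q)%N then p else q; pose j := if (p <= q)%N then q else p.-1.
have ij : (i <= j <= n.-2)%N by rewrite /i /j; case: (leqP p q) => pq; lia.
exists (take i L1), (drop i (take j L1)), (drop j L1), (take n (drop n.-2 L)),
  (drop n (drop n.-2 L)).
have ti : take i L1 = take i (take j L1) by rewrite take_takel //; lia.
have E1 : take i L1 ++ drop i (take j L1) = take j L1 by rewrite ti cat_take_drop.
split.
- by rewrite !cat_take_drop catA E1 catA !cat_take_drop.
- by rewrite catA E1 cat_take_drop s1.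
- by rewrite size_takel ?size_drop ?sL; lia.
- by rewrite !size_drop sL; lia.
rewrite E1 !size_takel ?s1; try lia.
by rewrite /i /j; case: leqP.
Qed.

Lemma pair_word_cat p q x1 x2 x3 b c :
  size (x1 ++ x2 ++ x3) = n.-2 -> size b = n -> size c = n ->
  (if (p <= q)%N then size x1 = p /\ size (x1 ++ x2) = q
    else size x1 = q /\ size (x1 ++ x2) = p.-1) ->
  pair_word p q (x1 ++ x2 ++ x3 ++ b ++ c) =
  if (p <= q)%N then x1 ++ c ++ x2 ++ b ++ x3 else x1 ++ b ++ x2 ++ c ++ x3.
Proof.
move=> sx sb sc H; rewrite /pair_word.
have -> : x1 ++ x2 ++ x3 ++ b ++ c = (x1 ++ x2 ++ x3) ++ b ++ c by rewrite -!catA.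
rewrite !(drop_size_cat _ sx) !(take_size_cat _ sx) (drop_size_cat _ sb).
rewrite (take_size_cat _ sb) /insb2; case: (leqP p q) H => pq [s1 s2].
  rewrite (take_size_cat _ s1) !(catA x1 x2) (drop_size_cat _ s2).
  by rewrite (take_size_cat _ s2) (drop_size_cat _ s1).
rewrite (drop_size_cat _ s1) (take_size_cat _ s1).
have s2' : size x2 = (p.-1 - q)%N by move: s2; rewrite size_cat s1; lia.
by rewrite (drop_size_cat _ s2') (take_size_cat _ s2').
Qed.

Lemma pair_posE p q L : (p < n)%N -> (q < n.-1)%N -> size L = N -> uniq L ->
  (0%N \in take n (drop n.-2 L)) = pair_pos p q (index 0%N (pair_word p q L)).
Proof.
move=> pn qn sL; rewrite -(perm_uniq (perm_pair_word p q L)).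
have [x1 [x2 [x3 [b [c [-> sx sb sc H]]]]]] := pair_split pn qn sL.
rewrite pair_word_cat // => uW.
have -> : x1 ++ x2 ++ x3 ++ b ++ c = (x1 ++ x2 ++ x3) ++ b ++ c by rewrite -!catA.
rewrite (drop_size_cat _ sx) (take_size_cat _ sb) /pair_pos.
move: uW; case: (leqP p q) H => pq [s1 s2] uW.
  rewrite (@index_mid _ _ (x1 ++ c ++ x2) b x3); last first.
    by move: uW; rewrite !catA => /uniq_catl.
  have s2' : size x2 = (q - p)%N by move: s2; rewrite size_cat s1; lia.
  rewrite -!catA !size_cat sb sc s1 s2'; move: (index _ _) => k.
  by congr (_ <= _ < _)%N; lia.
rewrite (@index_mid _ _ x1 b (x2 ++ c ++ x3)) ?s1 ?sb //.
by move: uW; rewrite catA => /uniq_catl.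
Qed.

(** The contributions of [x3] cancel, and each letter of the gap [x2] between the two blocks
    contributes [n+1]. If [p <= q], the blocks also cross each other: the [n * n] inversions have
    the parity of [n], and with the remaining 1 from the exponent [n-1-p] they give one more
    multiple of [n+1]. *)
Lemma pair_word_sign p q L : (p < n)%N -> (q < n.-1)%N -> size L = N -> uniq L ->
  (-1) ^+ (n.-2 - q) * ((-1) ^+ (n.-1 - p) * word_sign R L) =
  (-1) ^+ (n.+1 * (if (p <= q)%N then (q - p)%N.+1 else (p.-1 - q)%N)) *
    word_sign R (pair_word p q L).
Proof.
move=> pn qn sL uL.
have [x1 [x2 [x3 [b [c [LE sx sb sc H]]]]]] := pair_split pn qn sL.
move: uL; rewrite LE pair_word_cat // => uL.
have uniq_perm_tail (s t : seq nat) :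
    perm_eq (t ++ s) (x2 ++ x3 ++ b ++ c) -> uniq s.
  by move=> /perm_uniq st; have := uniq_catr uL; rewrite -st => /uniq_catr.
have tail (t s : seq nat) :
    (forall P, count P (t ++ s) = count P (x2 ++ x3 ++ b ++ c)) -> uniq s.
  by move=> /seq.permP /uniq_perm_tail.
have cx : n.-2 = (size x1 + size x2 + size x3)%N by rewrite -sx !size_cat addnA.
case: (leqP p q) H => pq [s1]; rewrite size_cat s1 => s2.
  have u3b : uniq (x3 ++ b) by apply: (tail (x2 ++ c)) => P; rewrite !count_cat; lia.
  have uMc : uniq ((x2 ++ b ++ x3) ++ c).
    by apply: (tail [::]) => P; rewrite !count_cat /=; lia.
  have := word_sign_swap R (x1 ++ x2) c u3b; rewrite -!catA => ->.
  have := word_sign_swap R x1 [::] uMc; rewrite !cats0 -!catA => ->.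
  rewrite !mulrA; congr (_ * _); rewrite -!exprD.
  rewrite !size_cat sb sc -signr_odd -[RHS]signr_odd; congr (_ ^+ (nat_of_bool _)).
  have -> : (n.-1 - p = size x2 + size x3 + 1)%N by lia.
  have -> : (n.-2 - q = size x3)%N by lia.
  have -> : (q - p = size x2)%N by lia.
  rewrite !(oddD, oddM, oddS).
  by case: (odd n); case: (odd (size x2)); case: (odd (size x3)).
have u23b : uniq ((x2 ++ x3) ++ b) by apply: (tail c) => P; rewrite !count_cat; lia.
have u3c : uniq (x3 ++ c) by apply: (tail (x2 ++ b)) => P; rewrite !count_cat; lia.
have := word_sign_swap R x1 c u23b; rewrite -!catA => ->.
have := word_sign_swap R (x1 ++ b ++ x2) [::] u3c; rewrite !cats0 -!catA => ->.
rewrite !mulrA; congr (_ * _); rewrite -!exprD.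
rewrite !size_cat sb sc -signr_odd -[RHS]signr_odd; congr (_ ^+ (nat_of_bool _)).
have -> : (n.-1 - p = size x3)%N by lia.
have -> : (n.-2 - q = size x2 + size x3)%N by lia.
have -> : (p.-1 - q = size x2)%N by lia.
rewrite !(oddD, oddM, oddS).
by case: (odd n); case: (odd (size x2)); case: (odd (size x3)).
Qed.

End Reindexing.

(** * Comparing the coefficients *)

Section Coefficients.
Variables (n : nat).
Hypothesis n_ge2 : (2 <= n)%N.

Definition nested_pairs : seq (nat * nat) :=
  [seq (p, q) | p <- index_iota 0 n, q <- index_iota 0 n].

Definition pair_pairs : seq (nat * nat) :=
  [seq (p, q) | q <- index_iota 0 n.-1, p <- index_iota 0 n].

Definition nested_exp (pq : nat * nat) : nat := (n.+1 * (n.-1 - pq.2))%N.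

Definition pair_exp (pq : nat * nat) : nat :=
  (n.+1 * (if pq.1 <= pq.2 then (pq.2 - pq.1).+1 else pq.1.-1 - pq.2))%N.

(* In the bracketing of [F2] attached to [(p, q)], the block containing [t_1]
   starts [p] letters before [t_1]. The case [k < p + q] is the one in which the
   other block lies to the right of [t_1]. *)
Definition nested_to_pair k (pq : nat * nat) : nat * nat :=
  if (k < pq.1 + pq.2)%N then (k + n - pq.1 - pq.2, k - pq.1)%N
  else (k - n - pq.1 - pq.2, k - n - pq.1)%N.

(** The new first component is the offset of $t_1$ in its block. The second is read off the gap
    between the two blocks, which is [n-1-q] in the first case and [q] in the second, for the nested
    pair [(p, q)]. *)
Definition pair_to_nested k (pq : nat * nat) : nat * nat :=
  if (pq.2 < pq.1)%N then (k - pq.2, n - (pq.1 - pq.2))%N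
  else (k - n - pq.2, pq.2 - pq.1)%N.

Lemma mem_nested_pairs p q : ((p, q) \in nested_pairs) = (p < n)%N && (q < n)%N.
Proof.
apply/allpairsP/andP => [[[p' q'] [/= + + [-> ->]]]|[pn qn]].
  by rewrite !mem_index_iota.
by exists (p, q); rewrite !mem_index_iota.
Qed.

Lemma mem_pair_pairs p q : ((p, q) \in pair_pairs) = (p < n)%N && (q < n.-1)%N.
Proof.
apply/allpairsP/andP => [[[p' q'] [/= + + [-> ->]]]|[pn qn]].
  by rewrite !mem_index_iota.
by exists (q, p); rewrite !mem_index_iota.
Qed.

Lemma perm_nested_to_pair k :
  perm_eq [seq nested_to_pair k pq | pq <- nested_pairs & nested_pos n pq.1 pq.2 k]
    [seq pq <- pair_pairs | pair_pos n pq.1 pq.2 k].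
Proof.
have K1 : {in [seq pq <- nested_pairs | nested_pos n pq.1 pq.2 k],
    cancel (nested_to_pair k) (pair_to_nested k)}.
  move=> [p q]; rewrite mem_filter mem_nested_pairs /nested_pos /=.
  rewrite /nested_to_pair /pair_to_nested /=.
  case: (ltnP k (p + q)) => kpq /= H.
    by rewrite ifT; [congr (_, _)|]; lia.
  by rewrite ifF; [congr (_, _)|]; lia.
have K2 : {in [seq pq <- pair_pairs | pair_pos n pq.1 pq.2 k],
    cancel (pair_to_nested k) (nested_to_pair k)}.
  move=> [p q]; rewrite mem_filter mem_pair_pairs /pair_pos /=.
  rewrite /nested_to_pair /pair_to_nested /=.
  case: (leqP p q) => pq /= H.
    by rewrite ifF; [congr (_, _)|]; lia.
  by rewrite ifT; [congr (_, _)|]; lia.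
have uI m : uniq (index_iota 0 m) by exact: iota_uniq.
apply: uniq_perm.
- rewrite map_inj_in_uniq ?filter_uniq //; last exact: can_in_inj K1.
  by apply: allpairs_uniq => // -[? ?] [? ?] _ _ /= [-> ->].
- rewrite filter_uniq //.
  by apply: allpairs_uniq => // -[? ?] [? ?] _ _ /= [-> ->].
move=> pq; apply/mapP/idP => [[[p q] + ->]|pqP].
  rewrite mem_filter mem_nested_pairs /nested_pos /= => H.
  rewrite /nested_to_pair /=; case: ifP => kpq.
    by rewrite mem_filter mem_pair_pairs /pair_pos /= ifF; lia.
  by rewrite mem_filter mem_pair_pairs /pair_pos /= ifT; lia.
exists (pair_to_nested k pq); last by rewrite K2.
case: pq pqP => p q; rewrite mem_filter mem_pair_pairs /pair_pos /pair_to_nested /=.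
by case: (leqP p q) => pq H; rewrite mem_filter mem_nested_pairs /nested_pos /=; lia.
Qed.

(** For odd [n] both exponents are even. For even [n], the bijection turns [n-1-q] into [n-1-q] if
    $t_1$ precedes the innermost block and into [q+1] if it follows it, and these have the same
    parity. *)
Lemma coefficient_eq (R : pzRingType) k :
  \sum_(pq <- nested_pairs | nested_pos n pq.1 pq.2 k) (-1) ^+ nested_exp pq =
  \sum_(pq <- pair_pairs | pair_pos n pq.1 pq.2 k) (-1) ^+ pair_exp pq :> R.
Proof.
rewrite -[RHS]big_filter -(perm_big _ (perm_nested_to_pair k)) big_map big_filter.
rewrite [LHS]big_seq_cond [RHS]big_seq_cond; apply: eq_bigr => -[p q].
rewrite mem_nested_pairs /nested_pos /= => H.
rewrite -signr_odd -[RHS]signr_odd /nested_exp /pair_exp !oddM oddS /=.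
case: (boolP (odd n)) => //= on; congr (_ ^+ (nat_of_bool _)).
rewrite /nested_to_pair /=; case: (ltnP k (p + q)) => kpq /=.
  by rewrite ifF; lia.
by rewrite ifT; lia.
Qed.

End Coefficients.

(** * Exchange of the sums over words and over pairs *)

Section Main.
Variables (K : fieldType) (V : lmodType K).
Variables (n : nat) (mu : n.-tuple V -> V).
Hypothesis n_ge2 : (2 <= n)%N.
Hypothesis mu_lin : is_multilinear mu.
Hypothesis muA : total_associative mu.
Variable a : (3 * n - 2).-tuple V.

Local Notation N := (3 * n - 2)%N.
Local Notation words := (permutations (iota 0 N)).

Definition word_term (W : seq nat) : V := word_sign K W *: prod3 mu (map (nth 0 a) W).

Lemma words_uniq L : L \in words -> size L = N /\ uniq L.
Proof.
rewrite mem_permutations => LN.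
by rewrite (perm_size LN) size_iota (perm_uniq LN) iota_uniq.
Qed.

Lemma mem0_perm (l l' : seq nat) : perm_eq l l' -> (0%N \in l) = (0%N \in l').
Proof. by move/perm_mem. Qed.

(** With [(p, q)] fixed, [nested_word] permutes all words at once, so the summand becomes a term
    that no longer involves the pair, and the pair survives only in a sign and in the range of the
    position of [0]. *)
Lemma F1_sum : F1 (lie_commutator mu) a =
  \sum_(pq <- nested_pairs n) (-1) ^+ nested_exp n pq *:
    \sum_(W <- words | nested_pos n pq.1 pq.2 (index 0%N W)) word_term W.
Proof.
rewrite F1_words // big_allpairs_dep.
transitivity (\sum_(x <- words | sorted_blocks n.-1 n.-1 x
      && (0%N \in take n.-1 (drop n.-1 x))) word_sign K x *:
    \sum_(0 <= p < n) (-1) ^+ (n.-1 - p) *: \sum_(0 <= q < n) (-1) ^+ (n.-1 - q) *: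
      alt (take n.-1 x) (fun l1 => alt (take n.-1 (drop n.-1 x)) (fun l2 =>
        alt (drop n.-1 (drop n.-1 x)) (fun l3 =>
          prod3 mu (map (nth 0 a) (insb p (insb q l3 l2) l1)))))).
  rewrite big_seq_cond [RHS]big_seq_cond; apply: eq_bigr => x.
  case/andP=> /words_uniq[sx ux] _.
  rewrite expand_nested ?take_uniq ?drop_uniq ?size_takel ?size_drop ?sx //; lia.
rewrite exchange_scale; apply: eq_big_nat => p /andP[_ pn].
rewrite exchange_scale scaler_sumr; apply: eq_big_nat => q /andP[_ qn].
rewrite (@alt_shuffles _ _ n.-1 n.-1 _ (fun l => 0%N \in l)
  (fun l1 l2 l3 => prod3 mu (map (nth 0 a) (insb p (insb q l3 l2) l1))));
  [|exact: iota_uniq|by rewrite size_iota; lia|exact: mem0_perm].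
rewrite !scaler_sumr -[RHS](@reindex_words _ _ (nested_word n p q)); first last.
- by move=> s _; apply: perm_nested_word.
- by move=> f s; apply: map_nested_word.
rewrite big_seq_cond [RHS]big_seq_cond; apply: eq_big => [L|L].
  case: (boolP (L \in _)) => //= /words_uniq[sL uL].
  exact: nested_posE.
case/andP=> /words_uniq[sL uL] _.
rewrite /word_term !scalerA; congr (_ *: _).
by rewrite -mulrA nested_word_sign.
Qed.

Lemma F2_sum : F2 (lie_commutator mu) a =
  \sum_(pq <- pair_pairs n) (-1) ^+ pair_exp n pq *:
    \sum_(W <- words | pair_pos n pq.1 pq.2 (index 0%N W)) word_term W.
Proof.
rewrite F2_words // big_allpairs_dep.
transitivity (\sum_(x <- words | sorted_blocks n.-2 n x
      && (0%N \in take n (drop n.-2 x))) word_sign K x *: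
    \sum_(0 <= q < n.-1) (-1) ^+ (n.-2 - q) *: \sum_(0 <= p < n) (-1) ^+ (n.-1 - p) *:
      alt (take n.-2 x) (fun l1 => alt (take n (drop n.-2 x)) (fun l2 =>
        alt (drop n (drop n.-2 x)) (fun l3 =>
          prod3 mu (map (nth 0 a) (insb2 p q l2 l3 l1)))))).
  rewrite big_seq_cond [RHS]big_seq_cond; apply: eq_bigr => x.
  case/andP=> /words_uniq[sx ux] _.
  rewrite expand_pair ?take_uniq ?drop_uniq ?size_takel ?size_drop ?sx //; lia.
rewrite exchange_scale; apply: eq_big_nat => q /andP[_ qn].
rewrite exchange_scale scaler_sumr; apply: eq_big_nat => p /andP[_ pn].
rewrite (@alt_shuffles _ _ n.-2 n _ (fun l => 0%N \in l)
  (fun l1 l2 l3 => prod3 mu (map (nth 0 a) (insb2 p q l2 l3 l1))));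
  [|exact: iota_uniq|by rewrite size_iota; lia|exact: mem0_perm].
rewrite !scaler_sumr -[RHS](@reindex_words _ _ (pair_word n p q)); first last.
- by move=> s _; apply: perm_pair_word.
- by move=> f s; apply: map_pair_word.
rewrite big_seq_cond [RHS]big_seq_cond; apply: eq_big => [L|L].
  case: (boolP (L \in _)) => //= /words_uniq[sL uL].
  exact: pair_posE.
case/andP=> /words_uniq[sL uL] _.
rewrite /word_term !scalerA; congr (_ *: _).
by rewrite -mulrA pair_word_sign.
Qed.

Lemma sum_words_by_coefficient (r : seq (nat * nat)) (c : nat * nat -> K)
    (P : nat * nat -> nat -> bool) :
  \sum_(pq <- r) c pq *: \sum_(W <- words | P pq (index 0%N W)) word_term W =
  \sum_(W <- words) (\sum_(pq <- r | P pq (index 0%N W)) c pq) *: word_term W.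
Proof.
under eq_bigr => pq _ do rewrite scaler_sumr.
rewrite (exchange_big_dep xpredT) //=; apply: eq_bigr => W _.
by rewrite scaler_suml.
Qed.

Lemma F1_eq_F2 : F1 (lie_commutator mu) a = F2 (lie_commutator mu) a.
Proof.
rewrite F1_sum F2_sum.
rewrite (sum_words_by_coefficient _ _ (fun pq => nested_pos n pq.1 pq.2)).
rewrite (sum_words_by_coefficient _ _ (fun pq => pair_pos n pq.1 pq.2)).
by apply: eq_bigr => W _; rewrite coefficient_eq.
Qed.

End Main.

Theorem theorem1p2 (n : nat) (K : fieldType) (A : lmodType K)
  (mu : n.-tuple A -> A) :
  (2 <= n)%N ->
  is_multilinear mu ->
  total_associative mu ->
  forall a : (3 * n - 2).-tuple A, f2 (lie_commutator mu) a (-1) = 0.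
Proof.
move=> n_ge2 mu_lin muA a.
by rewrite /f2 scaleN1r F1_eq_F2 // subrr.
Qed.
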